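(* Consider the nonconvex-linear minimax problem, with the standing assumptions, the smoothed function $\Phi_\gamma$ (with a fixed $\gamma\ge 0$ such that $\mu_h+\gamma>0$), the gradient mapping $\mathcal{G}_\eta$ and Algorithm 1 as described in the context. Let $\Lambda_0\ge 1$ and $\Lambda_1\ge 0$ be such that, for the step size $\eta$ used by the algorithm, $\|\nabla\Phi_\gamma(w)\|^2\le \Lambda_0\|\mathcal{G}_\eta(w)\|^2+\Lambda_1$ for all $w$. (i) (Arbitrary permutations.) There exist positive constants $c, C$, depending only on $\mu_h,\gamma,M_h,\|K\|,M_F,L_F,\sigma_J,\Lambda_0,\Lambda_1$, $\Psi_0(\widetilde w_0)-\Psi_0^\star$ and $\sup_{u\in\mathrm{dom}(h)}|b(u)|$, such that for every sufficiently small $\epsilon>0$: if Algorithm 1 is run with arbitrary permutations $\pi^{(t)},\hat\pi^{(t)}$ and constant step size $\eta_t=\eta:=c\,\epsilon$ (so $\eta=\mathcal{O}(\epsilon)$) for $T:=\lceil C\epsilon^{-3}\rceil=\mathcal{O}(\epsilon^{-3})$ epochs, then $$\frac{1}{T+1}\sum_{t=0}^{T}\|\mathcal{G}_{\eta}(\widetilde w_t)\|^2\le \epsilon^2 .$$ (ii) (Random permutations.) There exist positive constants $c, C$, depending only on the same quantities and on $n\Lambda_1$, such that for every sufficiently small $\epsilon>0$: if Algorithm 1 is run with uniformly random and independent permutations $\pi^{(t)},\hat\pi^{(t)}$ and constant step size $\eta_t=\eta:=c\,\sqrt{n}\,\epsilon$ for $T:=\lceil C n^{-1/2}\epsilon^{-3}\rceil$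 epochs, then $$\frac{1}{T+1}\sum_{t=0}^{T}\mathbb{E}\big[\|\mathcal{G}_{\eta}(\widetilde w_t)\|^2\big]\le \epsilon^2 .$$
   Context: Problem: $\min_{w\in\mathbb{R}^p}\max_{u\in\mathbb{R}^q}\{f(w)+\frac1n\sum_{i=1}^n\mathcal{H}_i(w,u)-h(u)\}$ with $\mathcal{H}_i(w,u)=\langle F_i(w),Ku\rangle$, $F_i:\mathbb{R}^p\to\mathbb{R}^m$, $K\in\mathbb{R}^{m\times q}$; $f:\mathbb{R}^p\to\mathbb{R}\cup\{+\infty\}$ and $h:\mathbb{R}^q\to\mathbb{R}\cup\{+\infty\}$ proper, closed, convex. $F:=\frac1n\sum_i F_i$; $[n]=\{1,\dots,n\}$. Assumptions: $h$ is $\mu_h$-strongly convex with $\mu_h\ge 0$ ($\mu_h=0$ meaning merely convex), and $\|u\|\le M_h<\infty$ for $u\in\mathrm{dom}(h)$. Each $F_i$ is continuously differentiable, with $L_{F_i}$-Lipschitz Jacobian $\nabla F_i$, and is $M_{F_i}$-Lipschitz; $L_F:=\max_iL_{F_i}$, $M_F:=\max_iM_{F_i}$. There is $\sigma_J>0$ with $\frac1n\sum_i\|\nabla F_i(w)-\nabla F(w)\|^2\le\sigma_J^2$ for all $w$. With $\Phi_0(w):=\max_u\{\langle F(w),Ku\rangle-h(u)\}$ and $\Psi_0:=f+\Phi_0$, one has $\Psi_0^\star:=\inf_w\Psi_0(w)>-\infty$. Smoothing: $b:\mathbb{R}^q\to\mathbb{R}$ is a fixed closed $1$-strongly convex function;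 $\phi_\gamma(v):=\max_u\{\langle v,Ku\rangle-h(u)-\gamma b(u)\}$ with unique maximizer $u^*_\gamma(v)$; $\Phi_\gamma(w):=\phi_\gamma(F(w))$, $\Psi_\gamma:=f+\Phi_\gamma$; $\nabla\Phi_\gamma(w)=\nabla F(w)^\top Ku^*_\gamma(F(w))$. Gradient mapping: $\mathcal{G}_\eta(w):=\eta^{-1}\big(w-\mathrm{prox}_{\eta f}(w-\eta\nabla\Phi_\gamma(w))\big)$, where $\mathrm{prox}_{\eta f}(w)=\arg\min_v\{f(v)+\frac1{2\eta}\|v-w\|^2\}$. Algorithm 1: start from $\widetilde w_0\in\mathrm{dom}(\Psi_0)$. At epoch $t=1,2,\dots,T$: set $w_0^{(t)}:=\widetilde w_{t-1}$; generate permutations $\pi^{(t)},\hat\pi^{(t)}$ of $[n]$; for $i=1,\dots,n$ compute $F_i^{(t)}$ either by Option 1, $F_i^{(t)}:=\frac1n\big[\sum_{j=1}^iF_{\pi^{(t)}(j)}(w_{j-1}^{(t)})+\sum_{j=i+1}^nF_{\pi^{(t)}(j)}(w_0^{(t)})\big]$, or by Option 2, $F_i^{(t)}:=F(w_0^{(t)})$; set $\nabla F_i^{(t)}:=\nabla F_{\hat\pi^{(t)}(i)}(w_{i-1}^{(t)})$, $\widetilde\nabla\Phi_\gamma(w_{i-1}^{(t)}):=(\nabla F_i^{(t)})^\top Ku_\gamma^*(F_i^{(t)})$, and $w_i^{(t)}:=w_{i-1}^{(t)}-\frac{\eta_t}{n}\widetilde\nabla\Phi_\gamma(w_{i-1}^{(t)})$.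 Finally $\widetilde w_t:=\mathrm{prox}_{\eta_tf}(w_n^{(t)})$. In the random case, $\pi^{(t)}$ and $\hat\pi^{(t)}$ are uniformly random, independent of each other and of the past. *)

(* Defs.v *)
From HB Require Import structures.
From mathcomp Require Export all_boot all_order all_algebra all_fingroup.
From mathcomp Require Export all_classical all_reals all_analysis.
Import Order.TTheory GRing.Theory Num.Theory.
Import numFieldNormedType.Exports.

Set Implicit Arguments.
Unset Strict Implicit.
Unset Printing Implicit Defensive.

Local Open Scope classical_set_scope.
Local Open Scope ring_scope.

(* Vectors are rows, as for the library's Jacobian: [K u] reads [u *m K^T],
   and [A^T v] reads [v *m A]. *)

Section Euclidean.
Variable R : realType.

Definition dotp k (x y : 'rV[R]_k) : R := \sum_i x ord0 i * y ord0 i.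

(* The library norm on matrices is the sup norm; it is used below only
   through its topology and differentials. *)
Definition enorm k (x : 'rV[R]_k) : R := Num.sqrt (dotp x x).

Definition opnorm k l (A : 'M[R]_(k, l)) : R :=
  sup [set enorm (x *m A^T) | x in [set x : 'rV[R]_l | enorm x <= 1]].

(* The usual k x l Jacobian matrix; ['J] is its transpose. *)
Definition jac k l (G : 'rV[R]_l -> 'rV[R]_k) (w : 'rV[R]_l) : 'M[R]_(k, l) :=
  ('J G w)^T.

Definition grad k (g : 'rV[R]_k -> R) (w : 'rV[R]_k) : 'rV[R]_k :=
  \row_j 'd g w (delta_mx ord0 j).

End Euclidean.

Section ConvexAnalysis.
Variables (R : realType) (k : nat).
Implicit Types g : 'rV[R]_k -> \bar R.
Local Open Scope ereal_scope.

Definition edom g : set 'rV[R]_k := [set x | g x < +oo].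

Definition proper_fun g := (forall x, -oo < g x) /\ edom g !=set0.

Definition closed_fun g :=
  closed [set z : 'rV[R]_k * R | g z.1 <= (z.2)%:E].

Definition convex_fun g := forall (t : R) x y, (0 <= t <= 1)%R ->
  g (t *: x + (1 - t) *: y)%R <= t%:E * g x + (1 - t)%:E * g y.

Definition strongly_convex_fun (mu : R) g :=
  convex_fun (fun x => g x - (mu / 2 * enorm x ^+ 2)%:E).

(* The default value 0 is returned only if there is no minimizer (maximizer). *)
Definition argmin g : 'rV[R]_k := xget 0%R [set x | forall y, g x <= g y].

Definition argmax g : 'rV[R]_k := xget 0%R [set x | forall y, g y <= g x].

Definition prox (eta : R) g (w : 'rV[R]_k) : 'rV[R]_k :=
  argmin (fun v => g v + ((2 * eta)^-1 * enorm (v - w)%R ^+ 2)%:E).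

End ConvexAnalysis.

Record minimax (R : realType) (n p q m : nat) := Minimax {
  f_ : 'rV[R]_p -> \bar R;
  h_ : 'rV[R]_q -> \bar R;
  b_ : 'rV[R]_q -> R;
  K_ : 'M[R]_(m, q);
  F_ : 'I_n -> 'rV[R]_p -> 'rV[R]_m;
  lipF_ : 'I_n -> R;
  lipJ_ : 'I_n -> R }.

Inductive estimator := Option1 | Option2.

Section Minimax.
Variables (R : realType) (n p q m : nat) (D : minimax R n p q m).

Definition Fmean (w : 'rV[R]_p) : 'rV[R]_m := n%:R^-1 *: \sum_i F_ D i w.

Definition MF : R := \big[Num.max/0]_i lipF_ D i.

Definition LF : R := \big[Num.max/0]_i lipJ_ D i.

Definition smoothed_obj (gamma : R) (v : 'rV[R]_m) (u : 'rV[R]_q) : \bar R :=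
  ((dotp v (u *m (K_ D)^T))%:E - h_ D u - (gamma * b_ D u)%:E)%E.

Definition phi (gamma : R) (v : 'rV[R]_m) : \bar R :=
  ereal_sup (range (smoothed_obj gamma v)).

Definition ustar (gamma : R) (v : 'rV[R]_m) : 'rV[R]_q :=
  argmax (smoothed_obj gamma v).

Definition Phi (gamma : R) (w : 'rV[R]_p) : \bar R := phi gamma (Fmean w).

Definition Psi (gamma : R) (w : 'rV[R]_p) : \bar R :=
  (f_ D w + Phi gamma w)%E.

Definition Psi0_star : \bar R := ereal_inf (range (Psi 0)).

Definition gradPhi (gamma : R) : 'rV[R]_p -> 'rV[R]_p :=
  grad (fun w => fine (Phi gamma w)).

Definition gradient_mapping (gamma eta : R) (w : 'rV[R]_p) : 'rV[R]_p :=
  eta^-1 *: (w - prox eta (f_ D) (w - eta *: gradPhi gamma w)).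

Record standing_assumptions (muh Mh sigmaJ : R) : Prop := {
  f_proper : proper_fun (f_ D);
  f_closed : closed_fun (f_ D);
  f_convex : convex_fun (f_ D);
  h_proper : proper_fun (h_ D);
  h_closed : closed_fun (h_ D);
  muh_ge0 : 0 <= muh;
  h_strongly_convex : strongly_convex_fun muh (h_ D);
  h_bounded_dom : forall u, edom (h_ D) u -> enorm u <= Mh;
  F_differentiable : forall i w, differentiable (F_ D i) w;
  F_continuous_jac : forall i, continuous (jac (F_ D i));
  lipJ_ge0 : forall i, 0 <= lipJ_ D i;
  F_lipschitz_jac : forall i x y,
    opnorm (jac (F_ D i) x - jac (F_ D i) y) <= lipJ_ D i * enorm (x - y);
  lipF_ge0 : forall i, 0 <= lipF_ D i;
  F_lipschitz : forall i x y,
    enorm (F_ D i x - F_ D i y) <= lipF_ D i * enorm (x - y);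
  sigmaJ_gt0 : 0 < sigmaJ;
  F_variance : forall w,
    n%:R^-1 * \sum_i opnorm (jac (F_ D i) w - jac Fmean w) ^+ 2 <= sigmaJ ^+ 2;
  Psi0_bounded_below : (-oo < Psi0_star)%E;
  b_closed : closed_fun (EFin \o b_ D);
  b_strongly_convex : strongly_convex_fun 1 (EFin \o b_ D) }.

(* The index [i : 'I_n] is the inner iteration i + 1, which starts from the
   inner iterate [w i]. *)
Definition F_estimate (o : estimator) (pi : 'S_n) (w : nat -> 'rV[R]_p)
    (i : 'I_n) : 'rV[R]_m :=
  match o with
  | Option1 => n%:R^-1 *: (\sum_(j < n | (j <= i)%N) F_ D (pi j) (w j)
                         + \sum_(j < n | (i < j)%N) F_ D (pi j) (w 0%N))
  | Option2 => Fmean (w 0%N)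
  end.

Definition inner_loop (o : estimator) (gamma eta : R) (pi pih : 'S_n)
    (w : nat -> 'rV[R]_p) : Prop :=
  forall i : 'I_n, w i.+1 = w i - (eta / n%:R) *:
    (ustar gamma (F_estimate o pi w i) *m (K_ D)^T *m jac (F_ D (pih i)) (w i)).

(* The index [t : 'I_T] is epoch t + 1, which maps [wt t] to [wt t.+1]. *)
Definition algorithm1_run (o : estimator) (gamma : R) (T : nat)
    (eta : 'I_T -> R) (pi pih : 'I_T -> 'S_n) (wt0 : 'rV[R]_p)
    (wt : nat -> 'rV[R]_p) : Prop :=
  wt 0%N = wt0 /\
  forall t : 'I_T, exists w : nat -> 'rV[R]_p,
    [/\ w 0%N = wt t,
        inner_loop o gamma (eta t) (pi t) (pih t) w &
        wt t.+1 = prox (eta t) (f_ D) (w n)].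

(* Everything the constants of the theorem are allowed to depend on, except
   the two constants of the gradient growth condition. *)
Record has_constants (wt0 : 'rV[R]_p)
    (muh gamma Mh normK mF lF sigmaJ Delta supb : R) : Prop := {
  assumptions : standing_assumptions muh Mh sigmaJ;
  start_dom : edom (Psi 0) wt0;
  normKE : opnorm (K_ D) = normK;
  MFE : MF = mF;
  LFE : LF = lF;
  DeltaE : (Psi 0 wt0 - Psi0_star)%E = Delta%:E;
  supbE : ereal_sup [set `|b_ D u|%:E | u in edom (h_ D)] = supb%:E }.

Definition gradient_growth (gamma eta Lambda0 Lambda1 : R) : Prop :=
  forall w, enorm (gradPhi gamma w) ^+ 2 <=
            Lambda0 * enorm (gradient_mapping gamma eta w) ^+ 2 + Lambda1.

End Minimax.

Section Randomness.
Variables (R : realType) (d : measure_display) (Om : measurableType d).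
Variable (P : probability Om R).
Local Open Scope ereal_scope.

(* Random variables with values in a finite (discrete) set. *)
Definition discrete_rv (S : finType) (X : Om -> S) :=
  forall s, measurable (X @^-1` [set s]).

Definition mutually_independent (I S : finType) (X : I -> Om -> S) :=
  forall (J : {set I}) (A : I -> set S),
    P (\bigcap_(i in [set` J]) (X i @^-1` A i)) =
    \prod_(i in J) P (X i @^-1` A i).

Definition uniform_rv (S : finType) (X : Om -> S) :=
  forall s, P (X @^-1` [set s]) = (#|S|%:R^-1)%:E.

Definition random_permutations (n T : nat) (pi pih : 'I_T -> Om -> 'S_n) :=
  let X (j : 'I_T * bool) := if j.2 then pi j.1 else pih j.1 in
  [/\ forall j, discrete_rv (X j), forall j, uniform_rv (X j) &
      mutually_independent X].

End Randomness.

(* Main.v *)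
(* One epoch is a proximal step [w |-> prox (w - eta (grad Phi(w) + e))] whose
   error [e] is controlled by the distances travelled by the inner iterates.
   [Phi] has a Lipschitz gradient because the smoothed maximum is the maximum of
   a strongly concave problem whose maximizer depends on the data in a Lipschitz
   way; hence the step decreases [psi = f + Phi] by [(eta / 4) |G|^2] up to
   [(3 / 2) eta |e|^2].  Summing over the epochs, plus one fictitious exact step
   from the last iterate, bounds the average of [|G|^2].

   For arbitrary permutations, [|e| = O(eta)] because the inner steps are bounded.
   For random ones, the inner iterates follow, to first order in [eta], the partial
   sums of the component gradients drawn without replacement.  Their mean square is
   at most [2 |grad Phi|^2 + O(1 / n)], since distinct draws are negatively
   correlated: this gains the factor [1 / n], and the growth condition turns
   [|grad Phi|^2] into [|G|^2], absorbed by the decrease.  Only the randomness of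
   [pih] is used.  As all the permutations take finitely many values, expectations
   are uniform averages over a finite set. *)
From HB Require Import structures.
Require Import Defs.
From mathcomp Require Import measurable_realfun ring lra.
Import Order.TTheory GRing.Theory Num.Theory.
Import numFieldNormedType.Exports.
Set Implicit Arguments.
Unset Strict Implicit.
Unset Printing Implicit Defensive.
Local Open Scope classical_set_scope.
Local Open Scope ring_scope.

(** * Euclidean geometry *)

Section EuclideanSpace.
Variable R : realType.
Implicit Types (k l : nat).

Lemma dotpC k (x y : 'rV[R]_k) : dotp x y = dotp y x.
Proof. by apply: eq_bigr => i _; rewrite mulrC. Qed.

Lemma dotpDl k (x y z : 'rV[R]_k) : dotp (x + y) z = dotp x z + dotp y z.
Proof.
by rewrite /dotp -big_split; apply: eq_bigr => i _; rewrite mxE mulrDl.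
Qed.

Lemma dotpZl k a (x z : 'rV[R]_k) : dotp (a *: x) z = a * dotp x z.
Proof.
by rewrite /dotp mulr_sumr; apply: eq_bigr => i _; rewrite mxE mulrA.
Qed.

Lemma dotpNl k (x z : 'rV[R]_k) : dotp (- x) z = - dotp x z.
Proof. by rewrite -scaleN1r dotpZl mulN1r. Qed.

Lemma dotpBl k (x y z : 'rV[R]_k) : dotp (x - y) z = dotp x z - dotp y z.
Proof. by rewrite dotpDl dotpNl. Qed.

Lemma dotp0l k (z : 'rV[R]_k) : dotp 0 z = 0.
Proof. by rewrite /dotp big1// => i _; rewrite mxE mul0r. Qed.

Lemma dotpDr k (x y z : 'rV[R]_k) : dotp z (x + y) = dotp z x + dotp z y.
Proof. by rewrite dotpC dotpDl !(dotpC z). Qed.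

Lemma dotpZr k a (x z : 'rV[R]_k) : dotp z (a *: x) = a * dotp z x.
Proof. by rewrite dotpC dotpZl (dotpC z). Qed.

Lemma dotpNr k (x z : 'rV[R]_k) : dotp z (- x) = - dotp z x.
Proof. by rewrite dotpC dotpNl (dotpC z). Qed.

Lemma dotpBr k (x y z : 'rV[R]_k) : dotp z (x - y) = dotp z x - dotp z y.
Proof. by rewrite dotpDr dotpNr. Qed.

Lemma dotp0r k (z : 'rV[R]_k) : dotp z 0 = 0.
Proof. by rewrite dotpC dotp0l. Qed.

Lemma dotp_suml k (I : Type) (r : seq I) (P : pred I) (x : I -> 'rV[R]_k) z :
  dotp (\sum_(i <- r | P i) x i) z = \sum_(i <- r | P i) dotp (x i) z.
Proof. by elim/big_rec2: _ => [|i a b _ <-]; rewrite ?dotp0l ?dotpDl. Qed.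

Lemma dotp_sumr k (I : Type) (r : seq I) (P : pred I) (x : I -> 'rV[R]_k) z :
  dotp z (\sum_(i <- r | P i) x i) = \sum_(i <- r | P i) dotp z (x i).
Proof. by rewrite dotpC dotp_suml; apply: eq_bigr => i _; rewrite dotpC. Qed.

Definition dotpE := (dotpDl, dotpDr, dotpNl, dotpNr, dotpZl, dotpZr).

Lemma dotp_mulmxl k l (x : 'rV[R]_k) (A : 'M[R]_(k, l)) y :
  dotp (x *m A) y = dotp x (y *m A^T).
Proof.
rewrite /dotp (eq_bigr (fun j => \sum_i x ord0 i * A i j * y ord0 j)); last first.
  by move=> j _; rewrite mxE mulr_suml.
rewrite exchange_big; apply: eq_bigr => i _.
rewrite mxE mulr_sumr; apply: eq_bigr => j _.
by rewrite mxE -mulrA [A i j * _]mulrC.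
Qed.

Lemma dotp_ge0 k (x : 'rV[R]_k) : 0 <= dotp x x.
Proof. by apply: sumr_ge0 => i _; rewrite -expr2 sqr_ge0. Qed.

Lemma enorm_ge0 k (x : 'rV[R]_k) : 0 <= enorm x.
Proof. exact: sqrtr_ge0. Qed.

Lemma sqr_enorm k (x : 'rV[R]_k) : enorm x ^+ 2 = dotp x x.
Proof. by rewrite sqr_sqrtr ?dotp_ge0. Qed.

Lemma enorm0 k : enorm (0 : 'rV[R]_k) = 0.
Proof. by rewrite /enorm dotp0l sqrtr0. Qed.

Lemma enormZ k a (x : 'rV[R]_k) : enorm (a *: x) = `|a| * enorm x.
Proof.
by rewrite /enorm dotpZl dotpZr mulrA -expr2 sqrtrM ?sqr_ge0// sqrtr_sqr.
Qed.

Lemma enormN k (x : 'rV[R]_k) : enorm (- x) = enorm x.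
Proof. by rewrite -scaleN1r enormZ normrN1 mul1r. Qed.

Lemma enormBC k (x y : 'rV[R]_k) : enorm (x - y) = enorm (y - x).
Proof. by rewrite -enormN opprB. Qed.

Lemma sqr_enormD k (x y : 'rV[R]_k) :
  enorm (x + y) ^+ 2 = enorm x ^+ 2 + 2 * dotp x y + enorm y ^+ 2.
Proof. by rewrite !sqr_enorm !dotpE (dotpC y x); ring. Qed.

Lemma sqr_enormB k (x y : 'rV[R]_k) :
  enorm (x - y) ^+ 2 = enorm x ^+ 2 - 2 * dotp x y + enorm y ^+ 2.
Proof. by rewrite !sqr_enorm !dotpE (dotpC y x); ring. Qed.

Lemma enorm_eq0 k (x : 'rV[R]_k) : enorm x = 0 -> x = 0.
Proof.
move=> x0; have := sqr_enorm x; rewrite x0 expr0n /= => /esym/eqP.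
rewrite psumr_eq0 => [/allP h|i _]; last by rewrite -expr2 sqr_ge0.
apply/rowP => i; rewrite mxE; apply/eqP.
by have := h i (mem_index_enum _); rewrite mulf_eq0 orbb.
Qed.

(** Cauchy-Schwarz: expand the squared norm of [enorm y *: x - enorm x *: y] and cancel the factor
    [enorm x * enorm y] once it is positive. *)
Lemma dotp_le_enorm k (x y : 'rV[R]_k) : dotp x y <= enorm x * enorm y.
Proof.
have [/enorm_eq0 ->|x0] := eqVneq (enorm x) 0; first by rewrite dotp0l enorm0 mul0r.
have [/enorm_eq0 ->|y0] := eqVneq (enorm y) 0; first by rewrite dotp0r enorm0 mulr0.
have {x0 y0} xy : 0 < enorm x * enorm y.
  by rewrite mulr_gt0// lt_def ?x0 ?y0 enorm_ge0.
rewrite -(ler_pM2l xy).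
have := sqr_ge0 (enorm (enorm y *: x - enorm x *: y)).
rewrite sqr_enormB !enormZ !ger0_norm ?enorm_ge0// dotpZl dotpZr.
set u := enorm x in xy *; set v := enorm y in xy *; set w := dotp x y.
by rewrite (_ : _ + _ = 2 * ((u * v) * (u * v) - (u * v) * w)); [lra|ring].
Qed.

Lemma normr_dotp_le k (x y : 'rV[R]_k) : `|dotp x y| <= enorm x * enorm y.
Proof.
rewrite ler_norml dotp_le_enorm andbT lerNl -dotpNl.
by apply: le_trans (dotp_le_enorm _ _) _; rewrite enormN.
Qed.

Lemma enormD_le k (x y : 'rV[R]_k) : enorm (x + y) <= enorm x + enorm y.
Proof.
rewrite -(@ler_pXn2r _ 2) ?nnegrE ?addr_ge0 ?enorm_ge0//.
rewrite sqr_enormD; have := dotp_le_enorm x y; lra.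
Qed.

Lemma enorm_sum_le k (I : Type) (r : seq I) (P : pred I) (x : I -> 'rV[R]_k) :
  enorm (\sum_(i <- r | P i) x i) <= \sum_(i <- r | P i) enorm (x i).
Proof.
elim/big_rec2: _ => [|i a b _ h]; first by rewrite enorm0.
by apply: le_trans (enormD_le _ _) _; rewrite lerD2l.
Qed.

(** Take [y = x]. This duality turns bounds on scalar products, which pass through transposes and
    limits, into bounds on norms. *)
Lemma enorm_le_dotp k (x : 'rV[R]_k) (c : R) : 0 <= c ->
  (forall y, dotp x y <= c * enorm y) -> enorm x <= c.
Proof.
move=> c0 /(_ x); rewrite -sqr_enorm => h.
have [->//|x0] := eqVneq (enorm x) 0.
have {}x0 : 0 < enorm x by rewrite lt_def x0 enorm_ge0.
by rewrite -(ler_pM2r x0) -expr2.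
Qed.

Lemma coord_le_enorm k (x : 'rV[R]_k) j : `|x ord0 j| <= enorm x.
Proof.
rewrite -(@ler_pXn2r _ 2) ?nnegrE ?enorm_ge0// sqr_enorm real_normK ?num_real//.
rewrite /dotp (bigD1 j)//= -expr2 lerDl.
by apply: sumr_ge0 => i _; rewrite -expr2 sqr_ge0.
Qed.

Lemma norm_le_enorm k (x : 'rV[R]_k) : `|x| <= enorm x.
Proof.
rewrite [leLHS]/Num.norm /= mx_normrE; apply/bigmax_leP; split=> [|[i j] _] /=.
  exact: enorm_ge0.
by rewrite (ord1 i) coord_le_enorm.
Qed.

Lemma coord_le_norm k (x : 'rV[R]_k) j : `|x ord0 j| <= `|x|.
Proof.
rewrite [leRHS]/Num.norm /= mx_normrE.
by apply: (le_bigmax _ (fun ij => `|x ij.1 ij.2|) (ord0, j)).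
Qed.

(** With [norm_le_enorm], this makes the two norms equivalent and carries Euclidean estimates over
    to the library topology. *)
Lemma enorm_le_norm k (x : 'rV[R]_k) : enorm x <= k%:R * `|x|.
Proof.
rewrite [in leLHS](row_sum_delta x); apply: le_trans (enorm_sum_le _ _ _) _.
apply: (@le_trans _ _ (\sum_(j < k) `|x|)); last first.
  by rewrite sumr_const card_ord mulr_natl.
apply: ler_sum => j _; rewrite enormZ; suff -> : enorm (delta_mx ord0 j : 'rV[R]_k) = 1.
  by rewrite mulr1 coord_le_norm.
rewrite /enorm /dotp (bigD1 j)//= big1 => [|i ij]; last first.
  by rewrite !mxE (negbTE ij) andbF mulr0.
by rewrite !mxE !eqxx mulr1 addr0 sqrtr1.
Qed.

(** A crude constant: it shows that the supremum defining [opnorm] is taken over a bounded set. *)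
Lemma enorm_mulmx_bounded k l (A : 'M[R]_(k, l)) :
  exists2 c, 0 <= c & forall x : 'rV[R]_k, enorm (x *m A) <= c * enorm x.
Proof.
exists (\sum_i enorm (row i A)); first by apply: sumr_ge0 => i _; exact: enorm_ge0.
move=> x; rewrite mulmx_sum_row; apply: le_trans (enorm_sum_le _ _ _) _.
rewrite mulr_suml; apply: ler_sum => i _.
by rewrite enormZ mulrC ler_wpM2l ?enorm_ge0// coord_le_enorm.
Qed.

Lemma opnorm_set_has_sup k l (A : 'M[R]_(k, l)) :
  has_sup [set enorm (x *m A^T) | x in [set x : 'rV[R]_l | enorm x <= 1]].
Proof.
split; first by exists (enorm ((0 : 'rV[R]_l) *m A^T)), 0 => //=; rewrite enorm0 ler01.
have [c c0 h] := enorm_mulmx_bounded A^T; exists c => _ [x /= x1 <-].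
by apply: le_trans (h x) _; rewrite -[leRHS]mulr1 ler_wpM2l.
Qed.

Lemma opnorm_ge0 k l (A : 'M[R]_(k, l)) : 0 <= opnorm A.
Proof.
apply: (@le_trans _ _ (enorm ((0 : 'rV[R]_l) *m A^T))); first exact: enorm_ge0.
apply: ub_le_sup; first by have [] := opnorm_set_has_sup A.
by exists 0 => //=; rewrite enorm0 ler01.
Qed.

Lemma enorm_mulmxT_le k l (A : 'M[R]_(k, l)) (x : 'rV[R]_l) :
  enorm (x *m A^T) <= opnorm A * enorm x.
Proof.
have [x0|x0] := eqVneq (enorm x) 0.
  have [c _ /(_ x)] := enorm_mulmx_bounded A^T; rewrite x0 mulr0 => h.
  by rewrite mulr0.
have {}x0 : 0 < enorm x by rewrite lt_def x0 enorm_ge0.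
rewrite -ler_pdivrMr//.
have -> : enorm (x *m A^T) / enorm x = enorm (((enorm x)^-1 *: x) *m A^T).
  by rewrite -scalemxAl enormZ ger0_norm ?invr_ge0 ?enorm_ge0// mulrC.
apply: ub_le_sup; first by have [] := opnorm_set_has_sup A.
exists ((enorm x)^-1 *: x) => //=.
by rewrite enormZ ger0_norm ?invr_ge0 ?enorm_ge0// mulVf// gt_eqF.
Qed.

(** The transposed action obeys the same bound, by duality with [enorm_mulmxT_le]. *)
Lemma enorm_mulmx_le k l (A : 'M[R]_(k, l)) (y : 'rV[R]_k) :
  enorm (y *m A) <= opnorm A * enorm y.
Proof.
apply: enorm_le_dotp; first by rewrite mulr_ge0 ?opnorm_ge0 ?enorm_ge0.
move=> z; rewrite dotp_mulmxl; apply: le_trans (dotp_le_enorm _ _) _.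
rewrite [leRHS]mulrAC mulrC ler_wpM2r ?enorm_ge0//; exact: enorm_mulmxT_le.
Qed.

Lemma opnorm_le k l (A : 'M[R]_(k, l)) c : 0 <= c ->
  (forall x, enorm (x *m A^T) <= c * enorm x) -> opnorm A <= c.
Proof.
move=> c0 h; apply: ge_sup; first by have [] := opnorm_set_has_sup A.
by move=> _ [x /= x1 <-]; apply: le_trans (h x) _; rewrite -[leRHS]mulr1 ler_wpM2l.
Qed.

End EuclideanSpace.

(** * Lower semicontinuity and compactness *)

Section Semicontinuity.
Variable R : realType.

Lemma enorm_lipschitz_continuous k (g : 'rV[R]_k -> R) (c : R) :
  (forall x y, `|g x - g y| <= c * enorm (x - y)) -> continuous g.
Proof.
move=> gc x; apply/(@cvgrPdist_le _ _ _ _ (nbhs_filter x)) => e e0.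
pose M := `|c| * k%:R + 1.
have M0 : 0 < M by rewrite ltr_wpDl// mulr_ge0.
have : \forall y \near nbhs x, `|x - y| <= e / M.
  apply: (@cvgr_dist_le _ _ _ _ (nbhs_filter x) id x); last by rewrite divr_gt0.
  exact: cvg_id.
apply: filterS => y; rewrite ler_pdivlMr// mulrC; apply: le_trans.
apply: le_trans (gc x y) _.
apply: (@le_trans _ _ (`|c| * (k%:R * `|x - y|))).
  apply: (@le_trans _ _ (`|c| * enorm (x - y))).
    by rewrite ler_wpM2r ?enorm_ge0 ?ler_norm.
  by rewrite ler_wpM2l// enorm_le_norm.
by rewrite mulrA ler_wpM2r// /M lerDl.
Qed.

Lemma enorm_continuous k (c : 'rV[R]_k) : continuous (fun x : 'rV[R]_k => enorm (x - c)).
Proof.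
apply: (@enorm_lipschitz_continuous _ _ 1) => x y; rewrite mul1r ler_norml.
have -> : x - y = (x - c) - (y - c) by rewrite opprB addrA subrK.
set u := x - c; set v := y - c.
have := enormD_le (u - v) v; rewrite subrK.
have := enormD_le (v - u) u; rewrite subrK (enormBC v); lra.
Qed.

Lemma dotp_continuous k (c : 'rV[R]_k) : continuous (dotp c).
Proof.
apply: (@enorm_lipschitz_continuous _ _ (enorm c)) => x y.
by rewrite -dotpBr normr_dotp_le.
Qed.

Lemma enorm_ball_compact k (c : 'rV[R]_k) (r : R) :
  compact [set x : 'rV[R]_k | enorm (x - c) <= r].
Proof.
apply: bounded_closed_compact; last first.
  apply: (@preimage_closed _ _ (fun x : 'rV[R]_k => enorm (x - c)) [set x | x <= r]).
    by move=> x _; exact: enorm_continuous.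
  exact: closed_le.
exists (r + `|c|); split; first exact: num_real.
move=> M rM x /= xr; apply: le_trans (ltW rM).
rewrite -[x](subrK c); apply: le_trans (ler_normD _ _) _; rewrite lerD2r.
exact: le_trans (norm_le_enorm _) xr.
Qed.

(** A strict superlevel set is a horizontal slice of the complement of the epigraph. *)
Lemma closed_fun_lsc k (g : 'rV[R]_k -> \bar R) :
  closed_fun g -> lower_semicontinuous g.
Proof.
move=> cg; apply/lower_semicontinuousP => a.
rewrite (_ : [set x | _] = ~` ((fun x => (x, a)) @^-1`
    [set z : 'rV[R]_k * R | (g z.1 <= (z.2)%:E)%E])); last first.
  by apply/seteqP; split => x /=; rewrite ltNge => /negP.
apply: closed_openC; apply: preimage_closed => // x _.
by apply: (@cvg_pair _ _ _ (nbhs x) (nbhs x) (nbhs a) _ _ _ id (cst a));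
  [exact: cvg_id|exact: cvg_cst].
Qed.

Lemma continuous_lsc (T : topologicalType) (g : T -> R) :
  continuous g -> lower_semicontinuous (EFin \o g).
Proof.
move=> cg; apply/lower_semicontinuousP => a.
rewrite (_ : [set x | _] = g @^-1` [set r | a < r]); last first.
  by apply/seteqP; split => x /=; rewrite lte_fin.
by apply: open_comp; [move=> x _; exact: cg|exact: open_gt].
Qed.

(** If both values at [x] are finite, the excess over [a] is split equally between them; an infinite
    value can take any threshold, hence makes up for the other one. *)
Lemma lscD (T : topologicalType) (g h : T -> \bar R) :
  (forall x, -oo < g x)%E -> (forall x, -oo < h x)%E ->
  lower_semicontinuous g -> lower_semicontinuous h ->
  lower_semicontinuous (fun x => g x + h x)%E.
Proof.
move=> g0 h0 lg lh x a; move: (g0 x) (h0 x) (lg x) (lh x).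
have lscD' (s s' : R) : a <= s + s' ->
    (exists2 V, nbhs x V & forall y, V y -> s%:E < g y)%E ->
    (exists2 V, nbhs x V & forall y, V y -> s'%:E < h y)%E ->
    (exists2 V, nbhs x V & forall y, V y -> a%:E < g y + h y)%E.
  move=> as' [V Vx Vg] [W Wx Wh]; exists (V `&` W); first exact: filterI.
  move=> y [/Vg gy /Wh hy]; apply: (@le_lt_trans _ _ (s%:E + s'%:E)%E).
    by rewrite -EFinD lee_fin.
  exact: lteD.
case: (g x) => [u||]//; case: (h x) => [v||]// _ _ gx hx.
- rewrite -EFinD lte_fin => auv.
  apply: (lscD' ((a + u - v) / 2) ((a + v - u) / 2)); first lra.
  + by apply: gx; rewrite lte_fin; lra.
  + by apply: hx; rewrite lte_fin; lra.
- move=> _; apply: (lscD' (u - 1) (a - u + 1)); first lra.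
  + by apply: gx; rewrite lte_fin; lra.
  + by apply: hx; rewrite ltry.
- move=> _; apply: (lscD' (a - v + 1) (v - 1)); first lra.
  + by apply: gx; rewrite ltry.
  + by apply: hx; rewrite lte_fin; lra.
- move=> _; apply: (lscD' a 0); first lra.
  + by apply: gx; rewrite ltry.
  + by apply: hx; rewrite ltry.
Qed.

Lemma lsc_scale (T : topologicalType) (a : R) (g : T -> R) : 0 <= a ->
  lower_semicontinuous (EFin \o g) ->
  lower_semicontinuous (EFin \o (fun x => a * g x)).
Proof.
rewrite le_eqVlt => /predU1P[<- _|a0 lg x r /=].
  have -> : EFin \o (fun x => 0 * g x) = EFin \o (fun=> 0).
    by apply/funext => x /=; rewrite mul0r.
  by apply: continuous_lsc => x; exact: cvg_cst.
rewrite lte_fin mulrC -ltr_pdivrMr// => h.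
have [V Vx Vg] := lg x (r / a) h; exists V => // y /Vg /=.
by rewrite !lte_fin ltr_pdivrMr// mulrC.
Qed.

(** Without a minimizer, the open sets of points [x] with [g y < g x], for [y] in [K], cover [K]. In
    a finite subcover, the centre with the least value is itself uncovered. *)
Lemma lsc_compact_min (T : ptopologicalType) (K : set T) (g : T -> \bar R) :
  (forall x, -oo < g x)%E -> lower_semicontinuous g ->
  compact K -> K !=set0 ->
  exists2 x, K x & forall y, K y -> (g x <= g y)%E.
Proof.
move=> g0 lg cK [z Kz]; apply: contrapT => nomin.
have nomin' x : K x -> exists2 y, K y & (g y < g x)%E.
  move=> Kx; apply: contrapT => h; apply: nomin; exists x => // y Ky.
  by rewrite leNgt; apply/negP => gyx; apply: h; exists y.
move: cK; rewrite compact_cover => /(_ T K (fun y => [set x | (g y < g x)%E])).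
case.
- move=> y _; case: (g y) (g0 y) => [r _||//].
  + by move/lower_semicontinuousP : lg; exact.
  + move=> _; rewrite (_ : [set x | _] = set0); first exact: open0.
    by apply/seteqP; split => // x /=; rewrite ltNge leey.
- by move=> x Kx; have [y Ky gyx] := nomin' x Kx; exists y.
move=> D DK KD.
have [y0 /= y0D gy0] := KD z Kz.
have [i _ imin] := @Order.TotalTheory.arg_minP _ _ (seq_sub (finmap.enum_fset D))
  (SeqSub y0D) xpredT (fun j => g (val j)) isT.
have Ki : K (val i) by have := DK _ (valP i); rewrite inE.
have [j /= jD] := KD _ Ki.
by rewrite ltNge (imin (SeqSub jD)).
Qed.

End Semicontinuity.

(** * Strong convexity and proximal maps *)

Section StrongConvexity.
Variables (R : realType) (k : nat).
Implicit Types (g h : 'rV[R]_k -> \bar R) (mu : R).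

(** Restricting to finite values at [x] and [y] keeps the right-hand side real, so that no
    extended-real subtraction occurs and moduli simply add up under sums. *)
Definition strongly_convex_on_dom mu g := forall x y (a b t : R),
  g x = a%:E -> g y = b%:E -> 0 <= t <= 1 ->
  (g (t *: x + (1 - t) *: y)%R <=
    (t * a + (1 - t) * b - mu / 2 * (t * (1 - t)) * enorm (x - y) ^+ 2)%:E)%E.

Lemma sqr_enorm_convex (x y : 'rV[R]_k) (t : R) :
  enorm (t *: x + (1 - t) *: y) ^+ 2 =
  t * enorm x ^+ 2 + (1 - t) * enorm y ^+ 2 - t * (1 - t) * enorm (x - y) ^+ 2.
Proof. rewrite !sqr_enorm !dotpE (dotpC y x); ring. Qed.

Lemma strongly_convex_fun_on_dom mu g :
  strongly_convex_fun mu g -> strongly_convex_on_dom mu g.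
Proof.
move=> cg x y a b t gx gy t01; have := cg t x y t01.
rewrite gx gy -!EFinB -!EFinM -EFinD leeBlDr// -EFinD.
by move=> /le_trans; apply; rewrite lee_fin sqr_enorm_convex; lra.
Qed.

Lemma convex_fun_on_dom g : convex_fun g -> strongly_convex_on_dom 0 g.
Proof.
move=> cg x y a b t gx gy t01; have := cg t x y t01.
by rewrite gx gy -!EFinM -EFinD !mul0r subr0.
Qed.

Lemma strongly_convex_on_domD mu nu g h :
  (forall x, -oo < g x)%E -> (forall x, -oo < h x)%E ->
  strongly_convex_on_dom mu g -> strongly_convex_on_dom nu h ->
  strongly_convex_on_dom (mu + nu) (fun x => g x + h x)%E.
Proof.
move=> g0 h0 cg ch x y a b t.
move: (g0 x) (h0 x) (g0 y) (h0 y) (cg x y) (ch x y).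
case: (g x) (h x) (g y) (h y) => [gx||] [hx||] [gy||] [hy||] //= _ _ _ _.
move=> {}cg {}ch [<-] [<-] t01.
apply: le_trans (leeD (cg _ _ _ erefl erefl t01) (ch _ _ _ erefl erefl t01)) _.
by rewrite -EFinD lee_fin; lra.
Qed.

Lemma strongly_convex_quadratic (c : R) (w : 'rV[R]_k) :
  strongly_convex_on_dom (2 * c) (fun x => (c * enorm (x - w) ^+ 2)%:E).
Proof.
move=> x y a b t [<-] [<-] t01; rewrite lee_fin.
have -> : t *: x + (1 - t) *: y - w = t *: (x - w) + (1 - t) *: (y - w).
  by rewrite !scalerBr addrACA -opprD -scalerDl [t + _]addrC subrK scale1r.
have -> : x - y = (x - w) - (y - w) by rewrite opprB addrA subrK.
by rewrite sqr_enorm_convex; lra.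
Qed.

Lemma strongly_convex_scale (c : R) mu (g : 'rV[R]_k -> R) : 0 <= c ->
  strongly_convex_on_dom mu (EFin \o g) ->
  strongly_convex_on_dom (c * mu) (EFin \o (fun x => c * g x)).
Proof.
move=> c0 cg x y a b t [<-] [<-] t01; have := cg x y _ _ t erefl erefl t01.
rewrite /= !lee_fin => /(ler_wpM2l c0); lra.
Qed.

Lemma strongly_convex_dotp (c : 'rV[R]_k) :
  strongly_convex_on_dom 0 (EFin \o dotp c).
Proof.
move=> x y a b t [<-] [<-] t01; rewrite /= !mul0r subr0 lee_fin.
by rewrite dotpDr !dotpZr.
Qed.

(* Comparing a far point with its projection on the unit sphere around a point
   [x0] of the domain shows that the sublevel set of [x0] is bounded. *)
Lemma strongly_convex_has_min mu g : 0 < mu ->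
  proper_fun g -> lower_semicontinuous g -> strongly_convex_on_dom mu g ->
  exists x, forall y, (g x <= g y)%E.
Proof.
move=> mu0 [g0 [x0]]; rewrite /edom /= => gx0 lg cg.
pose ball r := [set x : 'rV[R]_k | enorm (x - x0) <= r].
have ball0 r : 0 <= r -> ball r x0 by rewrite /ball /= subrr enorm0.
have [z _ zmin] := lsc_compact_min g0 lg (@enorm_ball_compact R k x0 1)
  (ex_intro _ _ (ball0 1 ler01)).
move: (zmin _ (ball0 _ ler01)).
case Ex0 : (g x0) gx0 (g0 x0) => [b||]// _ _.
case Ez : (g z) (g0 z) zmin => [m||]// _ zmin; rewrite lee_fin => mb.
(* Past this radius the term [mu / 2 * (s - 1)] is at least [b - m], the largest drop of [g] from
   [x0] within the unit ball; this forces [b <= a]. *)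
pose r := 1 + 2 * (b - m) / mu.
have r1 : 1 <= r by rewrite lerDl divr_ge0 ?(ltW mu0)//; lra.
have [x Kx xmin] := lsc_compact_min g0 lg (@enorm_ball_compact R k x0 r)
  (ex_intro _ _ (ball0 r (le_trans ler01 r1))).
exists x => y; case: (leP (enorm (y - x0)) r) => [|ry]; first exact: xmin.
apply: le_trans (xmin _ (ball0 r (le_trans ler01 r1))) _; rewrite Ex0.
case Ey : (g y) (g0 y) => [a||]// _; last by rewrite leey.
set s := enorm (y - x0) in ry *.
have s1 : 1 < s by apply: le_lt_trans ry.
have s0 : 0 < s by lra.
have t01 : 0 <= s^-1 <= 1.
  by rewrite invr_ge0 ltW//= invf_le1// ltW.
have := zmin (s^-1 *: y + (1 - s^-1) *: x0).
have -> : s^-1 *: y + (1 - s^-1) *: x0 = x0 + s^-1 *: (y - x0).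
  by rewrite scalerBl scale1r scalerBr addrCA.
rewrite /ball /= addrAC subrr add0r enormZ -/s ger0_norm ?invr_ge0 ?(ltW s0)//.
rewrite mulVf ?gt_eqF// lexx => /(_ isT).
have := cg y x0 a b s^-1 Ey Ex0 t01.
have -> : s^-1 *: y + (1 - s^-1) *: x0 = x0 + s^-1 *: (y - x0).
  by rewrite scalerBl scale1r scalerBr addrCA.
move=> + /le_trans h => /h; rewrite !lee_fin -/s.
have -> : mu / 2 * (s^-1 * (1 - s^-1)) * s ^+ 2 = mu / 2 * (s - 1).
  by field; rewrite gt_eqF.
move=> /(ler_wpM2l (ltW s0)).
have -> : s * (s^-1 * a + (1 - s^-1) * b - mu / 2 * (s - 1)) =
  a + (s - 1) * b - s * (mu / 2 * (s - 1)).
  by field; rewrite gt_eqF.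
have : b - m <= mu / 2 * (s - 1).
  move: (ltW ry); rewrite /r -lerBrDl ler_pdivrMr//; lra.
move=> /(ler_wpM2l (ltW s0)); lra.
Qed.

(** Quadratic growth around a minimizer: otherwise a point of the segment from [x] to [y] would lie
    strictly below the minimum. *)
Lemma strongly_convex_min_le mu g x (a b : R) y :
  strongly_convex_on_dom mu g -> (forall y, (g x <= g y)%E) ->
  g x = a%:E -> g y = b%:E -> a + mu / 2 * enorm (y - x) ^+ 2 <= b.
Proof.
move=> cg xmin gx gy.
set q := mu / 2 * _; rewrite leNgt; apply/negP => ab.
have ab0 : a <= b by move: (xmin y); rewrite gx gy lee_fin.
have q0 : 0 < q by lra.
(* The minimizer over [t] of the strong convexity bound [t * b + (1 - t) * a - q * t * (1 - t)]. *)
pose t := (a + q - b) / (2 * q).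
have t0 : 0 < t by rewrite divr_gt0//; lra.
have t1 : t <= 1 by rewrite ler_pdivrMr; lra.
have tq : t * (2 * q) = a + q - b by rewrite mulfVK//; apply/eqP; lra.
have t01 : 0 <= t <= 1 by rewrite ltW.
have := le_trans (xmin _) (cg y x b a t gy gx t01).
rewrite gx lee_fin.
have -> : mu / 2 * (t * (1 - t)) * enorm (y - x) ^+ 2 = t * (q - t * q).
  by rewrite /q; ring.
have -> : t * q = (a + q - b) / 2 by lra.
rewrite leNgt; move/negP; apply.
have : 0 < t * (a + q - b) by rewrite mulr_gt0//; lra.
lra.
Qed.

Lemma argmin_le g : (exists x, forall y, (g x <= g y)%E) ->
  forall y, (g (argmin g) <= g y)%E.
Proof. by move=> h; exact: (xgetPex _ h). Qed.

End StrongConvexity.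

Section Prox.
Variables (R : realType) (p : nat) (f : 'rV[R]_p -> \bar R) (eta : R).
Hypotheses (fp : proper_fun f) (fcl : closed_fun f) (fco : convex_fun f).
Hypothesis eta0 : 0 < eta.

Let quad (w v : 'rV[R]_p) : R := (2 * eta)^-1 * enorm (v - w) ^+ 2.

Let prox_obj_strongly_convex w :
  strongly_convex_on_dom eta^-1 (fun v => f v + (quad w v)%:E)%E.
Proof.
have -> : eta^-1 = 0 + 2 * (2 * eta)^-1 by field; rewrite gt_eqF.
apply: strongly_convex_on_domD; [exact: fp.1|by move=> x; rewrite ltNyr|..].
  exact: convex_fun_on_dom.
exact: strongly_convex_quadratic.
Qed.

Let prox_min w y :
  (f (prox eta f w) + (quad w (prox eta f w))%:E <= f y + (quad w y)%:E)%E.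
Proof.
move: y; apply: argmin_le.
apply: (@strongly_convex_has_min _ _ eta^-1) => //; first by rewrite invr_gt0.
- split=> [x|].
    by case: (f x) (fp.1 x) => [r||]//; rewrite ?ltNyr ?ltNye.
  have [x] := fp.2; rewrite /edom /= => fx; exists x; rewrite /edom /=.
  by case: (f x) fx => [r _||]//; rewrite -EFinD ltry.
- apply: lscD; [exact: fp.1|by move=> x; rewrite ltNyr|..].
    exact: closed_fun_lsc.
  apply: continuous_lsc => x.
  apply: (@continuous_comp _ _ _ (fun v : 'rV[R]_p => enorm (v - w))
    (fun s => (2 * eta)^-1 * s ^+ 2)); first exact: enorm_continuous.
  by apply: cvgM; [exact: cvg_cst|exact: exprn_continuous].
Qed.

Lemma prox_dom w : exists a, f (prox eta f w) = a%:E.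
Proof.
have [x fx] := fp.2; have := prox_min w x.
have := fp.1 (prox eta f w); rewrite /edom /= in fx.
case: (f (prox eta f w)) => [r||]//; first by exists r.
by case: (f x) fx => [r||].
Qed.

(** The three-point inequality: quadratic growth of the proximal objective, whose modulus is
    [eta^-1]. *)
Lemma prox_le w y a b : f (prox eta f w) = a%:E -> f y = b%:E ->
  a + (2 * eta)^-1 * enorm (prox eta f w - w) ^+ 2 +
    (2 * eta)^-1 * enorm (y - prox eta f w) ^+ 2
  <= b + (2 * eta)^-1 * enorm (y - w) ^+ 2.
Proof.
move=> fa fb.
have := strongly_convex_min_le (@prox_obj_strongly_convex w) (prox_min w)
  (congr1 (fun r => r + (quad w _)%:E)%E fa)
  (congr1 (fun r => r + (quad w _)%:E)%E fb).
by have -> : eta^-1 / 2 = (2 * eta)^-1 by field; rewrite gt_eqF.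
Qed.

(** Adding the three-point inequalities of the two proximal points gives firm nonexpansiveness;
    Cauchy-Schwarz concludes. *)
Lemma prox_nonexpansive w1 w2 :
  enorm (prox eta f w1 - prox eta f w2) <= enorm (w1 - w2).
Proof.
have [a fa] := prox_dom w1; have [b fb] := prox_dom w2.
have := lerD (prox_le fa fb) (prox_le fb fa).
move: (prox eta f w1) (prox eta f w2) => v1 v2.
have c0 : 0 < (2 * eta)^-1 by rewrite invr_gt0 mulr_gt0.
move: (2 * eta)^-1 c0 => c c0 {fa fb} h.
have : enorm (v1 - v2) ^+ 2 <= dotp (v1 - v2) (w1 - w2).
  rewrite -(ler_pM2l c0); move: h.
  rewrite !sqr_enorm !dotpE (dotpC w1 v1) (dotpC w1 v2) (dotpC w2 v2) (dotpC w2 v1).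
  rewrite (dotpC v2 v1); lra.
have [->|v0] := eqVneq (enorm (v1 - v2)) 0; first by rewrite enorm_ge0.
have {}v0 : 0 < enorm (v1 - v2) by rewrite lt_def v0 enorm_ge0.
move=> /le_trans /(_ (dotp_le_enorm _ _)).
by rewrite expr2 ler_pM2l.
Qed.

End Prox.

(** * Gradients and Jacobians *)

Section Gradient.
Variables (R : realType) (k : nat).

Let dotp_linear (a : 'rV[R]_k) :
  linear_for *:%R (dotp a : 'rV[R]_k -> R^o).
Proof. by move=> c x y; rewrite dotpDr dotpZr. Qed.

HB.instance Definition _ (a : 'rV[R]_k) :=
  GRing.isLinear.Build R 'rV[R]_k R^o *:%R (dotp a) (@dotp_linear a).

(** A quadratic remainder is negligible at first order, so uniqueness of the differential identifies
    it with [dotp a]. The linear structure declared above lets [dotp a] be such a candidate. *)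
Lemma grad_unique (g : 'rV[R]_k -> R) (w a : 'rV[R]_k) (c : R) :
  (forall v, `|g v - g w - dotp a (v - w)| <= c * enorm (v - w) ^+ 2) ->
  grad g w = a.
Proof.
move=> ga.
have dg : 'd g w = dotp a :> (_ -> _).
  apply: (@diff_unique _ _ _ _ (dotp a : {linear 'rV[R]_k -> R^o})).
    exact: dotp_continuous.
  apply/eqaddoP => e e0.
  pose M := `|c| * k%:R ^+ 2 + 1.
  have M0 : 0 < M by rewrite ltr_wpDl// mulr_ge0// sqr_ge0.
  have : \forall y \near nbhs (0 : 'rV[R]_k), `|0 - y| <= e / M.
    apply: (@cvgr_dist_le _ _ _ _ (nbhs_filter (0 : 'rV[R]_k)) id 0).
      exact: cvg_id.
    by rewrite divr_gt0.
  apply: filterS => y; rewrite sub0r normrN ler_pdivlMr// mulrC => yM.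
  have -> : (g \o shift w - (cst (g w) + dotp a)) y =
      g (y + w) - g w - dotp a (y + w - w).
    rewrite [LHS]/GRing.add /=.
    by rewrite addrK -[RHS]addrA -opprD.
  apply: le_trans (ga _) _; rewrite addrK /=.
  apply: (@le_trans _ _ (M * `|y| * `|y|)); last by rewrite ler_wpM2r.
  apply: (@le_trans _ _ (`|c| * enorm y ^+ 2)).
    by rewrite ler_wpM2r ?sqr_ge0// ler_norm.
  apply: (@le_trans _ _ (`|c| * (k%:R * `|y|) ^+ 2)).
    rewrite ler_wpM2l// lerXn2r ?nnegrE ?enorm_ge0 ?mulr_ge0//.
    exact: enorm_le_norm.
  rewrite /M exprMn -mulrA -expr2 mulrDl mul1r mulrA lerDl; exact: sqr_ge0.
apply/rowP => j; rewrite mxE dg /dotp (bigD1 j)//= big1 => [|i ij].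
  by rewrite mxE !eqxx mulr1 addr0.
by rewrite mxE (negbTE ij) andbF mulr0.
Qed.

End Gradient.

Section Jacobian.
Variables (R : realType) (k l : nat) (G : 'rV[R]_l -> 'rV[R]_k).
Hypothesis dG : forall w, differentiable G w.

(** Pairing with [y] makes the difference quotients scalar, so that inequalities pass to the limit
    and the mean value theorem applies. *)
Let cvg_jac x d y :
  dotp y (h^-1 *: (G (h *: d + x) - G x)) @[h --> (0 : R)^'] -->
  dotp y (d *m (jac G x)^T).
Proof.
apply: (@continuous_cvg _ _ _ _ _ _ (dotp y)); first exact: dotp_continuous.
have := @diff_derivable _ _ _ G x d (dG x).
by rewrite /derivable -/(derive G x d) deriveEjacobian// /jac trmxK.
Qed.

Lemma opnorm_jac_le (c : R) w : 0 <= c ->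
  (forall x y, enorm (G x - G y) <= c * enorm (x - y)) ->
  opnorm (jac G w) <= c.
Proof.
move=> c0 lG; apply: opnorm_le => // d.
apply: enorm_le_dotp => [|y]; first by rewrite mulr_ge0 ?enorm_ge0.
rewrite dotpC; apply: (cvgr_to_le (@cvg_jac w d y)).
near=> h.
have h0 : h != 0 by near: h; exact: nbhs_dnbhs_neq.
apply: le_trans (dotp_le_enorm _ _) _; rewrite mulrC ler_wpM2r ?enorm_ge0//.
rewrite enormZ normfV ler_pdivrMl ?normr_gt0//.
by apply: le_trans (lG _ _) _; rewrite addrK enormZ mulrCA.
Unshelve. all: by end_near. Qed.

(** Mean value theorem for [dotp y] along the segment from [w] to [v]. It yields the constant [c],
    where integration would yield [c / 2]. *)
Lemma jac_taylor_le (c : R) w v y : 0 <= c ->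
  (forall x x', opnorm (jac G x - jac G x') <= c * enorm (x - x')) ->
  dotp y (G v - G w - (v - w) *m (jac G w)^T) <=
    c * enorm (v - w) ^+ 2 * enorm y.
Proof.
move=> c0 lG; set d := v - w.
pose g (s : R) := dotp y (G (s *: d + w)).
pose dg (s : R) := dotp y (d *m (jac G (s *: d + w))^T).
have gd (s : R) : is_derive s 1 g (dg s).
  have gE h : h^-1 *: ((g \o shift s) (h *: 1) - g s) =
      dotp y (h^-1 *: (G (h *: d + (s *: d + w)) - G (s *: d + w))).
    rewrite dotpZr dotpBr /g /=.
    by rewrite [h *: 1]mulr1 scalerDl addrA.
  have := @cvg_jac (s *: d + w) d y; under eq_fun do rewrite -gE.
  move=> cg; apply: DeriveDef; first by apply/cvg_ex; exists (dg s).
  exact: cvg_lim cg.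
have cg : {within `[0, 1], continuous g}.
  by apply: derivable_within_continuous => s _; have [] := gd s.
have [s] := MVT ltr01 (fun s _ => gd s) cg.
rewrite in_itv /= => /andP[s0 s1]; rewrite /g scale1r scale0r add0r subr0 mulr1.
rewrite /d subrK -/d => gs.
rewrite dotpBr dotpBr gs /dg -dotpBr -mulmxBr -linearB /=.
apply: le_trans (dotp_le_enorm _ _) _; rewrite mulrC ler_wpM2r ?enorm_ge0//.
apply: le_trans (enorm_mulmxT_le _ _) _.
rewrite expr2 mulrA ler_wpM2r ?enorm_ge0//.
have := lG (s *: d + w) w; rewrite addrK enormZ ger0_norm ?(ltW s0)//.
move=> h; apply: (le_trans h).
by rewrite ler_wpM2l// ler_piMl ?enorm_ge0// ltW.
Qed.

End Jacobian.

(** * The smoothed maximum *)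

Section SmoothedMax.
Variables (R : realType) (n p q m : nat) (D : minimax R n p q m).
Variables (muh Mh sigmaJ gamma : R).
Hypothesis HA : standing_assumptions D muh Mh sigmaJ.
Hypotheses (gamma0 : 0 <= gamma) (sigma0 : 0 < muh + gamma).

Let K := K_ D.
Let h := h_ D.
Let b := b_ D.
Let u_ := ustar D gamma.
Let sigma := muh + gamma.
Let kappa := opnorm K.
Let dom u := edom h u.

Let h_gtNy u : (-oo < h u)%E. Proof. by have [] := h_proper HA. Qed.

Let hE u : dom u -> h u = (fine (h u))%:E.
Proof. by rewrite /dom /edom /=; case: (h u) (h_gtNy u). Qed.

Let lin (v : 'rV[R]_m) u := gamma * b u + dotp (- (v *m K)) u.

Let linE v u : lin v u = gamma * b u - dotp v (u *m K^T).
Proof. by rewrite /lin dotpNl dotp_mulmxl. Qed.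

(** The opposite of the smoothed objective, so that maximizing becomes minimizing a strongly convex
    function. *)
Let obj v u := (h u + (lin v u)%:E)%E.

Let smoothed_objE v u : smoothed_obj D gamma v u = (- obj v u)%E.
Proof.
rewrite /smoothed_obj /obj linE -/h -/b -/K; case: (h u) => [r||]//.
by rewrite -!EFinB -EFinD -EFinN; congr EFin; lra.
Qed.

Let obj_strongly_convex v : strongly_convex_on_dom sigma (obj v).
Proof.
have -> : sigma = muh + (gamma * 1 + 0) by rewrite mulr1 addr0.
apply: strongly_convex_on_domD => //.
- by move=> u; rewrite ltNyr.
- exact/strongly_convex_fun_on_dom/(h_strongly_convex HA).
apply: (@strongly_convex_on_domD _ _ _ _ (EFin \o (fun u => gamma * b u))
  (EFin \o dotp (- (v *m K)))); [by move=> u; rewrite ltNyr..| |].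
  apply: strongly_convex_scale => //.
  exact/strongly_convex_fun_on_dom/(b_strongly_convex HA).
exact: strongly_convex_dotp.
Qed.

Let obj_min v u : (obj v (u_ v) <= obj v u)%E.
Proof.
suff : exists x, forall y, (obj v x <= obj v y)%E.
  move=> [x xmin].
  have : exists x, [set x | forall y,
      (smoothed_obj D gamma v y <= smoothed_obj D gamma v x)%E] x.
    by exists x => y /=; rewrite !smoothed_objE leeN2.
  by move=> /(xgetPex 0)/= /(_ u); rewrite !smoothed_objE leeN2.
apply: (@strongly_convex_has_min _ _ sigma) => //.
- split=> [x|].
    by rewrite /obj; case: (h x) (h_gtNy x) => [r||]//; rewrite ?ltNyr ?ltNye.
  have [x] := (h_proper HA).2; rewrite /edom /= => hx; exists x; rewrite /edom /obj /=.
  by move: hx; rewrite -/h; case: (h x) => [r _||]//; rewrite -EFinD ltry.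
apply: lscD => //; first by move=> x; rewrite ltNyr.
  exact/closed_fun_lsc/(h_closed HA).
apply: (@lscD _ _ (EFin \o (fun u => gamma * b u))
  (EFin \o dotp (- (v *m K)))); [by move=> x; rewrite ltNyr..| |].
  by apply: lsc_scale => //; exact/closed_fun_lsc/(b_closed HA).
by apply: continuous_lsc; exact: dotp_continuous.
Qed.

Lemma ustar_dom v : edom (h_ D) (u_ v).
Proof.
have [x] := (h_proper HA).2; rewrite /edom /= -/h => hx.
have := obj_min v x; rewrite /obj.
by case: (h (u_ v)) (h_gtNy (u_ v)) => [r||]//; case: (h x) hx.
Qed.

Lemma enorm_ustar_le v : enorm (u_ v) <= Mh.
Proof. exact/(h_bounded_dom HA)/ustar_dom. Qed.

Lemma Mh_ge0 : 0 <= Mh.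
Proof. exact: le_trans (enorm_ge0 _) (enorm_ustar_le 0). Qed.

Lemma enorm_Kustar_le v : enorm (u_ v *m (K_ D)^T) <= opnorm (K_ D) * Mh.
Proof.
apply: le_trans (enorm_mulmxT_le _ _) _.
by rewrite ler_wpM2l ?opnorm_ge0 ?enorm_ustar_le.
Qed.

Lemma phiE v : phi D gamma v =
  (dotp v (u_ v *m (K_ D)^T) - fine (h_ D (u_ v)) - gamma * b_ D (u_ v))%:E.
Proof.
have -> : (dotp v (u_ v *m (K_ D)^T) - fine (h_ D (u_ v)) - gamma * b_ D (u_ v))%:E
    = smoothed_obj D gamma v (u_ v).
  by rewrite /smoothed_obj -/h (hE (ustar_dom v)).
apply/eqP; rewrite eq_le; apply/andP; split.
  by apply: ub_ereal_sup => _ [u _ <-]; rewrite !smoothed_objE leeN2.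
by apply: ereal_sup_ubound; exists (u_ v).
Qed.

(** Quadratic growth of [obj v] around its minimizer [u_ v]. The regularity of [phi] and of the
    maximizer follows from this inequality alone. *)
Lemma phi_ge v u : edom (h_ D) u ->
  dotp v (u *m (K_ D)^T) - fine (h_ D u) - gamma * b_ D u
    + sigma / 2 * enorm (u - u_ v) ^+ 2 <= fine (phi D gamma v).
Proof.
move=> du; rewrite phiE /=.
have := @strongly_convex_min_le _ _ _ _ (u_ v) (fine (h (u_ v)) + lin v (u_ v))
  (fine (h u) + lin v u) u (@obj_strongly_convex v) (obj_min v).
rewrite /obj (hE (ustar_dom v)) (hE du) => /(_ erefl erefl).
by rewrite !linE -/h -/b -/K; lra.
Qed.

(** [u_ v *m (K_ D)^T] is a subgradient of [phi] at [v], as [u_ v] competes in the maximum at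
    [v']. *)
Lemma phi_lower v v' :
  fine (phi D gamma v) + dotp (v' - v) (u_ v *m (K_ D)^T) <= fine (phi D gamma v').
Proof.
have := phi_ge v' (ustar_dom v); rewrite [X in fine X + _]phiE /= dotpBl.
have : 0 <= sigma / 2 * enorm (u_ v - u_ v') ^+ 2.
  by rewrite mulr_ge0 ?sqr_ge0// divr_ge0// ltW.
lra.
Qed.

(** With [u_ v'] competing at [v], the growth term of [phi_ge] absorbs by Young's inequality the
    part of the cross term due to the motion of the maximizer. *)
Lemma phi_upper v v' : fine (phi D gamma v') <=
  fine (phi D gamma v) + dotp (v' - v) (u_ v *m (K_ D)^T)
    + opnorm (K_ D) ^+ 2 / sigma * enorm (v' - v) ^+ 2.
Proof.
have := phi_ge v (ustar_dom v'); rewrite [X in _ -> fine X <= _]phiE /= -/kappa -/K.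
move: (fine _) (fine _) => r1 r2.
have : dotp (v' - v) ((u_ v' - u_ v) *m K^T) <=
    kappa ^+ 2 / sigma * enorm (v' - v) ^+ 2 + sigma / 2 * enorm (u_ v' - u_ v) ^+ 2.
  apply: le_trans (dotp_le_enorm _ _) _.
  apply: (@le_trans _ _ (enorm (v' - v) * (kappa * enorm (u_ v' - u_ v)))).
    by rewrite ler_wpM2l ?enorm_ge0 ?enorm_mulmxT_le.
  set x := enorm (v' - v); set y := enorm (u_ v' - u_ v).
  rewrite -subr_ge0 -(pmulr_rge0 _ (_ : 0 < sigma)) //.
  have -> : sigma * (kappa ^+ 2 / sigma * x ^+ 2 + sigma / 2 * y ^+ 2 - x * (kappa * y))
    = ((kappa * x) ^+ 2 + (kappa * x - sigma * y) ^+ 2) / 2.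
    by field; rewrite gt_eqF.
  by rewrite divr_ge0// addr_ge0// sqr_ge0.
rewrite mulmxBl !(dotpBl, dotpBr); lra.
Qed.

(** Letting each maximizer compete in the other problem and adding, the values of [h] and [b]
    cancel: [sigma] times the squared distance of the maximizers is at most
    [dotp (v' - v) ((u_ v' - u_ v) *m K^T)]. *)
Lemma ustar_lipschitz v v' :
  enorm (u_ v' - u_ v) <= opnorm (K_ D) / sigma * enorm (v' - v).
Proof.
have := phi_ge v (ustar_dom v'); have := phi_ge v' (ustar_dom v).
rewrite !phiE /= -/K -/kappa.
move: (fine _) (fine _) => r1 r2.
have [->|u0] := eqVneq (enorm (u_ v' - u_ v)) 0.
  by rewrite mulr_ge0 ?enorm_ge0// divr_ge0 ?opnorm_ge0// ltW.
have {}u0 : 0 < enorm (u_ v' - u_ v) by rewrite lt_def u0 enorm_ge0.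
have : dotp (v' - v) ((u_ v' - u_ v) *m K^T) <=
    enorm (v' - v) * (kappa * enorm (u_ v' - u_ v)).
  apply: le_trans (dotp_le_enorm _ _) _.
  by rewrite ler_wpM2l ?enorm_ge0 ?enorm_mulmxT_le.
rewrite mulmxBl !(dotpBl, dotpBr) (enormBC (u_ v)) => h1 h2 h3.
rewrite mulrAC ler_pdivlMr// -(ler_pM2r u0).
rewrite -/sigma in h2 h3 *; lra.
Qed.

End SmoothedMax.

(** * The smoothed objective as a function of [w], and its gradient *)

Section SmoothedObjective.
Variables (R : realType) (n p q m : nat) (D : minimax R n p q m).
Variables (muh Mh sigmaJ gamma : R).
Hypothesis HA : standing_assumptions D muh Mh sigmaJ.
Hypotheses (gamma0 : 0 <= gamma) (sigma0 : 0 < muh + gamma).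
Hypothesis n0 : (0 < n)%N.

Definition component_grad (i : 'I_n) (w : 'rV[R]_p) : 'rV[R]_p :=
  ustar D gamma (Fmean D w) *m (K_ D)^T *m jac (F_ D i) w.

(** The first term accounts for the variation of the Jacobians, the second for that of the
    maximizer, which depends on [w] through [Fmean]. *)
Definition smoothness : R :=
  LF D * (opnorm (K_ D) * Mh) + MF D ^+ 2 * opnorm (K_ D) ^+ 2 / (muh + gamma).

Definition grad_bound : R := MF D * (opnorm (K_ D) * Mh).

Lemma MF_ge0 : 0 <= MF D. Proof. exact: bigmax_ge_id. Qed.

Lemma LF_ge0 : 0 <= LF D. Proof. exact: bigmax_ge_id. Qed.

Lemma lipF_le i : lipF_ D i <= MF D. Proof. exact: le_bigmax. Qed.

Lemma lipJ_le i : lipJ_ D i <= LF D. Proof. exact: le_bigmax. Qed.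

Lemma F_lipschitz_MF i x y :
  enorm (F_ D i x - F_ D i y) <= MF D * enorm (x - y).
Proof.
apply: le_trans (F_lipschitz HA i x y) _.
by rewrite ler_wpM2r ?enorm_ge0 ?lipF_le.
Qed.

Lemma jac_lipschitz_LF i x y :
  opnorm (jac (F_ D i) x - jac (F_ D i) y) <= LF D * enorm (x - y).
Proof.
apply: le_trans (F_lipschitz_jac HA i x y) _.
by rewrite ler_wpM2r ?enorm_ge0 ?lipJ_le.
Qed.

Lemma opnorm_jacF_le i w : opnorm (jac (F_ D i) w) <= MF D.
Proof.
apply: opnorm_jac_le; [exact: F_differentiable HA _|exact: MF_ge0|].
exact: F_lipschitz_MF.
Qed.

Lemma mulVn1 : n%:R^-1 * n%:R = 1 :> R.
Proof. by rewrite mulVf// pnatr_eq0 -lt0n. Qed.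

Lemma enorm_mean_le k (x : 'I_n -> 'rV[R]_k) (c : R) :
  (forall i, enorm (x i) <= c) -> enorm (n%:R^-1 *: \sum_i x i) <= c.
Proof.
move=> xc; rewrite enormZ ger0_norm ?invr_ge0//.
apply: (@le_trans _ _ (n%:R^-1 * \sum_(i < n) c)).
  rewrite ler_wpM2l ?invr_ge0//; apply: le_trans (enorm_sum_le _ _ _) _.
  by apply: ler_sum => i _.
by rewrite sumr_const card_ord -[c *+ n]mulr_natl mulrA mulVn1 mul1r.
Qed.

Lemma Fmean_lipschitz x y :
  enorm (Fmean D x - Fmean D y) <= MF D * enorm (x - y).
Proof.
rewrite -scalerBr -sumrB; apply: enorm_mean_le => i; exact: F_lipschitz_MF.
Qed.

Lemma smoothness_ge0 : 0 <= smoothness.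
Proof.
have Mh0 := Mh_ge0 HA gamma0 sigma0.
rewrite /smoothness addr_ge0//; first by rewrite !mulr_ge0 ?LF_ge0 ?opnorm_ge0.
by rewrite divr_ge0 ?(ltW sigma0)// mulr_ge0 ?sqr_ge0.
Qed.

Lemma grad_bound_ge0 : 0 <= grad_bound.
Proof.
by rewrite /grad_bound !mulr_ge0 ?MF_ge0 ?opnorm_ge0 ?(Mh_ge0 HA gamma0 sigma0).
Qed.

Lemma component_grad_le i w : enorm (component_grad i w) <= grad_bound.
Proof.
apply: le_trans (enorm_mulmx_le _ _) _; apply: ler_pM.
- exact: opnorm_ge0.
- exact: enorm_ge0.
- exact: opnorm_jacF_le.
- exact: (enorm_Kustar_le HA).
Qed.

Let g w := n%:R^-1 *: \sum_i component_grad i w.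

Let Fmean_taylor y v w :
  dotp y (Fmean D v - Fmean D w) <= 
  dotp y (n%:R^-1 *: \sum_i ((v - w) *m (jac (F_ D i) w)^T)) +
    LF D * enorm (v - w) ^+ 2 * enorm y.
Proof.
rewrite -lerBlDl -dotpBr -!scalerBr -!sumrB dotpZr dotp_sumr.
apply: (@le_trans _ _ (n%:R^-1 * \sum_(i < n) (LF D * enorm (v - w) ^+ 2 * enorm y))).
  rewrite ler_wpM2l ?invr_ge0//; apply: ler_sum => i _.
  apply: jac_taylor_le;
    [exact: F_differentiable HA i|exact: LF_ge0|exact: jac_lipschitz_LF].
move: (LF D * _ * _) => c.
by rewrite sumr_const card_ord -[c *+ n]mulr_natl mulrA mulVn1 mul1r.
Qed.

Let dotp_g w d :
  dotp (g w) d = dotp (ustar D gamma (Fmean D w) *m (K_ D)^T)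
    (n%:R^-1 *: \sum_i (d *m (jac (F_ D i) w)^T)).
Proof.
rewrite dotpZl dotpZr dotp_suml dotp_sumr; congr (_ * _).
by apply: eq_bigr => i _; rewrite /component_grad dotp_mulmxl.
Qed.

Let Phi_quadratic w v :
  `|fine (Phi D gamma v) - fine (Phi D gamma w) - dotp (g w) (v - w)| <=
  smoothness * enorm (v - w) ^+ 2.
Proof.
set y := ustar D gamma (Fmean D w) *m (K_ D)^T.
have yM : enorm y <= opnorm (K_ D) * Mh by exact: (enorm_Kustar_le HA).
have t1 := Fmean_taylor y v w.
(* The Taylor bound is one-sided in [y]; its instance at [- y] supplies the lower estimate. *)
have t2 := Fmean_taylor (- y) v w.
rewrite enormN !dotpNl in t2.
have r : LF D * enorm (v - w) ^+ 2 * enorm y <=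
    LF D * (opnorm (K_ D) * Mh) * enorm (v - w) ^+ 2.
  by rewrite [leRHS]mulrAC ler_wpM2l// mulr_ge0 ?LF_ge0 ?sqr_ge0.
have up := phi_upper HA gamma0 sigma0 (Fmean D w) (Fmean D v).
have lo := phi_lower HA gamma0 sigma0 (Fmean D w) (Fmean D v).
rewrite !(dotpC (Fmean D v - _)) -/y in up lo.
have s : opnorm (K_ D) ^+ 2 / (muh + gamma) * enorm (Fmean D v - Fmean D w) ^+ 2 <=
    MF D ^+ 2 * opnorm (K_ D) ^+ 2 / (muh + gamma) * enorm (v - w) ^+ 2.
  rewrite (_ : _ * _ * enorm (v - w) ^+ 2 =
    opnorm (K_ D) ^+ 2 / (muh + gamma) * (MF D * enorm (v - w)) ^+ 2); last by ring.
  rewrite ler_wpM2l ?divr_ge0 ?sqr_ge0 ?(ltW sigma0)//.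
  by rewrite lerXn2r ?nnegrE ?mulr_ge0 ?MF_ge0 ?enorm_ge0 ?Fmean_lipschitz.
have s0 : 0 <= MF D ^+ 2 * opnorm (K_ D) ^+ 2 / (muh + gamma) * enorm (v - w) ^+ 2.
  by rewrite mulr_ge0 ?sqr_ge0// divr_ge0 ?(ltW sigma0)// mulr_ge0 ?sqr_ge0.
rewrite /Phi dotp_g -/y /smoothness ler_norml mulrDl.
by apply/andP; split; lra.
Qed.

(** The two-sided quadratic bound gives differentiability and the value of the gradient at once,
    through [grad_unique]. *)
Lemma gradPhiE w : gradPhi D gamma w = n%:R^-1 *: \sum_i component_grad i w.
Proof. by apply: (@grad_unique _ _ _ _ _ smoothness) => v; exact: Phi_quadratic. Qed.

Lemma Phi_descent w v : fine (Phi D gamma v) <=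
  fine (Phi D gamma w) + dotp (gradPhi D gamma w) (v - w)
    + smoothness * enorm (v - w) ^+ 2.
Proof. by have := Phi_quadratic w v; rewrite gradPhiE ler_norml -/(g w); lra. Qed.

End SmoothedObjective.

(** * Sampling without replacement *)

(** Cauchy-Schwarz against the all-ones vector. *)
Lemma sqr_mean_le (R : realType) n (x : 'I_n -> R) : (0 < n)%N ->
  (n%:R^-1 * \sum_i x i) ^+ 2 <= n%:R^-1 * \sum_i x i ^+ 2.
Proof.
move=> n0; have nR : 0 < n%:R :> R by rewrite ltr0n.
have := normr_dotp_le (\row_i x i) (const_mx 1).
rewrite -(@ler_pXn2r _ 2) ?nnegrE ?mulr_ge0 ?enorm_ge0// exprMn !sqr_enorm /dotp.
rewrite real_normK ?num_real//.
under eq_bigr do rewrite !mxE mulr1.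
under [X in _ <= X * _]eq_bigr do rewrite !mxE -expr2.
under [X in _ <= _ * X]eq_bigr do rewrite !mxE mulr1.
rewrite sumr_const card_ord => h; rewrite exprMn expr2 -mulrA ler_pM2l ?invr_gt0//.
by rewrite mulrC ler_pdivrMr.
Qed.

Section WithoutReplacement.
Variables (R : realType) (n k : nat) (c : 'I_n -> 'rV[R]_k).
Hypothesis c_centered : \sum_i c i = 0.

Let corr (i j : 'I_n) : R := \sum_(s : 'S_n) dotp (c (s i)) (c (s j)).

Let corr_diag i : 0 <= corr i i.
Proof. by apply: sumr_ge0 => s _; exact: dotp_ge0. Qed.

(* Off-diagonal correlations are all equal by symmetry, and sum to minus the
   diagonal one because [c] is centered. *)
Let corr_offdiag i j : j != i -> corr i j <= 0.
Proof.
move=> ji.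
have row0 : \sum_l corr i l = 0.
  rewrite exchange_big big1// => s _; rewrite -dotp_sumr.
  have -> : \sum_l c (s l) = 0.
    by rewrite -[RHS]c_centered [RHS](reindex_inj (@perm_inj _ s)).
  exact: dotp0r.
have same l : l != i -> corr i l = corr i j.
  move=> li; rewrite /corr (reindex_inj (mulgI (tperm l j))).
  apply: eq_bigr => s _; rewrite !permM tpermL tpermD//.
move: row0; rewrite (bigD1 i)//= (eq_bigr (fun=> corr i j)) => [|l]; last exact: same.
rewrite sumr_const => h; rewrite leNgt; apply/negP => c0.
have : 0 < corr i j *+ #|[pred l | l != i]|.
  by rewrite pmulrn_lgt0//; apply/card_gt0P; exists j.
have := corr_diag i; lra.
Qed.

Lemma sum_perm_sqr_enorm_le (A : pred 'I_n) :
  \sum_(s : 'S_n) enorm (\sum_(i | A i) c (s i)) ^+ 2 <=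
  n`!%:R * \sum_i enorm (c i) ^+ 2.
Proof.
have -> : \sum_(s : 'S_n) enorm (\sum_(i | A i) c (s i)) ^+ 2 =
    \sum_(i | A i) \sum_(j | A j) corr i j.
  rewrite /corr.
  under [RHS]eq_bigr do rewrite exchange_big /=.
  rewrite exchange_big /=; apply: eq_bigr => s _.
  rewrite sqr_enorm dotp_suml; apply: eq_bigr => i _; exact: dotp_sumr.
apply: (@le_trans _ _ (\sum_i corr i i)).
  rewrite [leRHS](bigID A) /= -[leLHS]addr0 lerD//; last by apply: sumr_ge0 => i _.
  apply: ler_sum => i Ai; rewrite (bigD1 i)//= gerDl.
  by apply: sumr_le0 => j /andP[_ ji]; exact: corr_offdiag.
rewrite exchange_big /= (eq_bigr (fun=> \sum_i enorm (c i) ^+ 2)).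
  by rewrite sumr_const card_Sn -[leLHS]mulr_natl.
move=> s _; rewrite [RHS](reindex_inj (@perm_inj _ s)).
by apply: eq_bigr => i _; rewrite sqr_enorm.
Qed.

End WithoutReplacement.

(** Each partial mean is a fraction of the full mean plus a centered part. The latter has mean
    square at most [n%:R^-1 ^+ 2 * (n%:R * B ^+ 2)], whence the gain of a factor [n]. *)
Lemma mean_perm_partial_mean_le (R : realType) (n k : nat)
    (a : 'I_n -> 'rV[R]_k) (B : R) (i : nat) : (0 < n)%N -> (i <= n)%N ->
  (forall l, enorm (a l) <= B) ->
  n`!%:R^-1 * \sum_(s : 'S_n)
    enorm (n%:R^-1 *: \sum_(j < n | (j < i)%N) a (s j)) ^+ 2 <=
  2 * enorm (n%:R^-1 *: \sum_l a l) ^+ 2 + 2 * B ^+ 2 / n%:R.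
Proof.
move=> n0 le_in aB; set abar := n%:R^-1 *: _.
have nR : 0 < n%:R :> R by rewrite ltr0n.
have n1 := mulVn1 R n0.
have fR : 0 < n`!%:R :> R by rewrite ltr0n fact_gt0.
pose c l := a l - abar.
have sa : \sum_l a l = n%:R *: abar by rewrite scalerA mulrC n1 scale1r.
have c0 : \sum_l c l = 0.
  by rewrite sumrB sumr_const card_ord -scaler_nat sa subrr.
have cB : \sum_l enorm (c l) ^+ 2 <= n%:R * B ^+ 2.
  apply: (@le_trans _ _ (\sum_l enorm (a l) ^+ 2)).
    rewrite (eq_bigr (fun l =>
      (enorm (a l) ^+ 2 + enorm abar ^+ 2) - 2 * dotp (a l) abar)).
      rewrite sumrB big_split /= sumr_const card_ord -mulr_sumr -dotp_suml sa dotpZl.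
      rewrite -sqr_enorm -[_ *+ n]mulr_natl.
      have := mulr_ge0 (ltW nR) (sqr_ge0 (enorm abar)); lra.
    by move=> l _; rewrite sqr_enormB; ring.
  rewrite mulr_natl -[in leRHS](card_ord n) -sumr_const; apply: ler_sum => l _.
  by rewrite lerXn2r ?nnegrE ?enorm_ge0// (le_trans (enorm_ge0 _) (aB l)).
have step s : enorm (n%:R^-1 *: \sum_(j < n | (j < i)%N) a (s j)) ^+ 2 <=
    2 * enorm abar ^+ 2 +
    2 * n%:R^-1 ^+ 2 * enorm (\sum_(j < n | (j < i)%N) c (s j)) ^+ 2.
  set N := #|[pred j : 'I_n | (j < i)%N]|.
  have -> : n%:R^-1 *: \sum_(j < n | (j < i)%N) a (s j) =
      (n%:R^-1 * N%:R) *: abar + n%:R^-1 *: \sum_(j < n | (j < i)%N) c (s j).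
    rewrite sumrB sumr_const -[abar *+ _]scaler_nat scalerBr.
    rewrite -[RHS]/(_ + (_ - _ *: (N%:R *: _))).
    by rewrite -scalerA addrC subrK.
  have t0 : 0 <= n%:R^-1 * N%:R :> R by rewrite mulr_ge0 ?invr_ge0.
  have t1 : n%:R^-1 * N%:R <= 1 :> R.
    by rewrite ler_pdivrMl// mulr1 ler_nat (leq_trans (max_card _)) ?card_ord.
  move: (_ * N%:R) t0 t1 => t t0 t1; set y := \sum_(j < n | _) _.
  have -> : 2 * n%:R^-1 ^+ 2 * enorm y ^+ 2 = 2 * enorm (n%:R^-1 *: y) ^+ 2.
    by rewrite enormZ ger0_norm ?invr_ge0//; ring.
  have : enorm (t *: abar) ^+ 2 <= enorm abar ^+ 2.
    rewrite lerXn2r ?nnegrE ?enorm_ge0// enormZ ger0_norm//.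
    by rewrite ler_piMl ?enorm_ge0.
  have := sqr_ge0 (enorm (t *: abar - n%:R^-1 *: y)).
  rewrite sqr_enormB sqr_enormD; lra.
rewrite ler_pdivrMl//.
apply: (@le_trans _ _ (\sum_(s : 'S_n) (2 * enorm abar ^+ 2 +
    2 * n%:R^-1 ^+ 2 * enorm (\sum_(j < n | (j < i)%N) c (s j)) ^+ 2))).
  by apply: ler_sum => s _.
rewrite big_split /= sumr_const card_Sn -[_ *+ _]mulr_natl -mulr_sumr mulrDr lerD2l.
have := sum_perm_sqr_enorm_le c0 (fun j => (j < i)%N).
set S := \sum_(s : 'S_n) _ => SB.
apply: (@le_trans _ _ (2 * n%:R^-1 ^+ 2 * (n`!%:R * (n%:R * B ^+ 2)))).
  rewrite ler_wpM2l ?mulr_ge0 ?sqr_ge0//; apply: (le_trans SB).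
  by rewrite ler_wpM2l// ltW.
rewrite le_eqVlt; apply/orP; left; apply/eqP; field; by rewrite gt_eqF.
Qed.

(** * One epoch *)

Lemma sqr_enorm_triangle (R : realType) k (x y z : 'rV[R]_k) :
  enorm (x - z) ^+ 2 <= 2 * enorm (y - x) ^+ 2 + 2 * enorm (y - z) ^+ 2.
Proof.
have -> : x - z = (y - z) - (y - x) by apply/rowP => j; rewrite !mxE; ring.
move: (y - z) (y - x) => {}y {}x; have := sqr_ge0 (enorm (y + x)).
rewrite sqr_enormB sqr_enormD; lra.
Qed.

Lemma dotp_weighted_young (R : realType) k (c : R) (e d : 'rV[R]_k) :
  - c * dotp e d <= c ^+ 2 * enorm e ^+ 2 + enorm d ^+ 2 / 4.
Proof.
have := sqr_ge0 (enorm (c *: e + 2^-1 *: d)).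
rewrite sqr_enormD dotpZl dotpZr !enormZ !exprMn !real_normK ?num_real//; lra.
Qed.

Section Epoch.
Variables (R : realType) (n p q m : nat) (D : minimax R n p q m).
Variables (muh Mh sigmaJ gamma eta : R).
Hypothesis HA : standing_assumptions D muh Mh sigmaJ.
Hypotheses (gamma0 : 0 <= gamma) (sigma0 : 0 < muh + gamma).
Hypotheses (n0 : (0 < n)%N) (eta0 : 0 < eta).

Let L := smoothness D muh Mh gamma.
Let B := grad_bound D Mh.

Let L_ge0 : 0 <= L. Proof. exact: smoothness_ge0 HA _ _. Qed.
Let B_ge0 : 0 <= B. Proof. exact: grad_bound_ge0 HA gamma0 sigma0. Qed.
(** Since [fine] sends infinite values to 0, [psi] represents the smoothed objective only where
    [f_ D] is finite; hence the hypotheses of the form [f_ D w = a%:E]. *)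
Definition psi (w : 'rV[R]_p) : R := fine (f_ D w) + fine (Phi D gamma w).

Lemma prox_step (w0 e : 'rV[R]_p) (a : R) : 4 * smoothness D muh Mh gamma * eta <= 1 ->
  f_ D w0 = a%:E ->
  psi (prox eta (f_ D) (w0 - eta *: (gradPhi D gamma w0 + e)))
    + eta / 4 * enorm (gradient_mapping D gamma eta w0) ^+ 2
  <= psi w0 + 3 / 2 * eta * enorm e ^+ 2.
Proof.
rewrite -/L => Leta fa; set g := gradPhi D gamma w0.
(* [vb] is the exact proximal point, which defines the gradient mapping; [v] is the perturbed
   one. *)
set v := prox _ _ _; pose vb := prox eta (f_ D) (w0 - eta *: g).
have [[fp fcl] fco] := (f_proper HA, f_closed HA, f_convex HA).
have [bv fv] := prox_dom fp fcl fco eta0 (w0 - eta *: (g + e)).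
have h1 := prox_le fp fcl fco eta0 fv fa; rewrite -/v in fv h1.
have h2 := Phi_descent HA gamma0 sigma0 n0 w0 v; rewrite -/g -/L in h2.
have h3 : enorm (v - vb) <= eta * enorm e.
  apply: le_trans (prox_nonexpansive fp fcl fco eta0 _ _) _.
  have -> : w0 - eta *: (g + e) - (w0 - eta *: g) = - (eta *: e).
    by apply/rowP => j; rewrite !mxE; ring.
  by rewrite enormN enormZ gtr0_norm.
have h4 : enorm (v - vb) ^+ 2 <= eta ^+ 2 * enorm e ^+ 2.
  by rewrite -exprMn lerXn2r ?nnegrE ?mulr_ge0 ?enorm_ge0 ?(ltW eta0).
have h5 : eta ^+ 2 * enorm (gradient_mapping D gamma eta w0) ^+ 2 =
    enorm (w0 - vb) ^+ 2.
  rewrite /gradient_mapping -/g -/vb enormZ gtr0_norm ?invr_gt0//.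
  by field; rewrite gt_eqF.
clearbody v vb g.
have h6 := sqr_enorm_triangle w0 v vb.
have h7 := dotp_weighted_young eta e (v - w0).
have h8 : fine (f_ D v) + dotp (g + e) (v - w0) + eta^-1 * enorm (v - w0) ^+ 2 <= a.
  move: h1; rewrite fv /= (enormBC w0 v).
  have -> : v - (w0 - eta *: (g + e)) = (v - w0) + eta *: (g + e).
    by rewrite opprB addrCA addrC.
  have -> : w0 - (w0 - eta *: (g + e)) = eta *: (g + e).
    by rewrite opprB addrCA subrr addr0.
  rewrite sqr_enormD dotpZr (dotpC (v - w0)).
  set x := enorm (v - w0) ^+ 2; set y := enorm (eta *: _) ^+ 2; set z := dotp _ _.
  rewrite !mulrDr.
  have -> : (2 * eta)^-1 * (2 * (eta * z)) = z by field; rewrite gt_eqF.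
  have -> : eta^-1 * x = (2 * eta)^-1 * x + (2 * eta)^-1 * x by field; rewrite gt_eqF.
  lra.
(* After scaling by [eta], smoothness and Young's inequality each cost a quarter of
   [enorm (v - w0) ^+ 2]. The remaining half pays, through [h6], for a quarter of
   [enorm (w0 - vb) ^+ 2], at the price of another [eta ^+ 2 * enorm e ^+ 2 / 2]. *)
rewrite /psi fa /= -(ler_pM2l eta0).
move: h8 => /(ler_wpM2l (ltW eta0)).
rewrite dotpDl !mulrDr (mulrA eta eta^-1) mulfV ?gt_eqF// mul1r.
move: h2 => /(ler_wpM2l (ltW eta0)); rewrite !mulrDr.
have h9 : eta * (L * enorm (v - w0) ^+ 2) <= enorm (v - w0) ^+ 2 / 4.
  have := ler_wpM2r (sqr_ge0 (enorm (v - w0))) Leta.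
  by rewrite mul1r; set x := enorm _ ^+ 2; lra.
rewrite (_ : eta * (eta / 4 * _) = enorm (w0 - vb) ^+ 2 / 4); last by rewrite -h5; ring.
rewrite (_ : eta * (3 / 2 * eta * _) = 3 / 2 * (eta ^+ 2 * enorm e ^+ 2)); last by ring.
lra.
Qed.

Variables (o : estimator) (pi pih : 'S_n) (w : nat -> 'rV[R]_p).
Hypothesis loop : inner_loop D o gamma eta pi pih w.

Let dev (i : nat) := enorm (w i - w 0%N).
Let a k := component_grad D gamma k (w 0%N).
Let gh (i : 'I_n) : 'rV[R]_p :=
  ustar D gamma (F_estimate D o pi w i) *m (K_ D)^T *m jac (F_ D (pih i)) (w i).
Let meandev := n%:R^-1 * \sum_(j < n) dev j.
(** To first order in [eta], the displacement [w i - w 0%N] is [- eta] times this vector. *)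
Definition partial_mean (i : nat) :=
  n%:R^-1 *: \sum_(j < n | (j < i)%N) component_grad D gamma (pih j) (w 0%N).

Let loopE i : (i <= n)%N ->
  w i - w 0%N = - (eta *: (n%:R^-1 *: \sum_(j < n | (j < i)%N) gh j)).
Proof.
elim: i => [_|i IH i_n]; first by rewrite subrr big_pred0// !scaler0 oppr0.
have := loop (Ordinal i_n) => /= ->.
rewrite addrAC IH 1?ltnW// -opprD -scalerA -scalerDr -scalerDr.
suff -> : \sum_(j < n | (j < i.+1)%N) gh j =
  \sum_(j < n | (j < i)%N) gh j + gh (Ordinal i_n) by [].
rewrite (bigD1 (Ordinal i_n)) ?ltnSn//= addrC; congr (_ + _).
apply: eq_bigl => j; rewrite ltnS [in LHS]leq_eqVlt.
by rewrite -val_eqE /=; case: (ltngtP j i).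
Qed.

Let gh_le i : enorm (gh i) <= B.
Proof.
apply: le_trans (enorm_mulmx_le _ _) _; apply: ler_pM.
- exact: opnorm_ge0.
- exact: enorm_ge0.
- exact: (opnorm_jacF_le HA).
- exact: (enorm_Kustar_le HA).
Qed.

Let partial_le k (x : 'I_n -> 'rV[R]_k) (c : R) (i : nat) : 0 <= c ->
  (forall j, enorm (x j) <= c) ->
  enorm (n%:R^-1 *: \sum_(j < n | (j < i)%N) x j) <= c.
Proof.
move=> c0 xc; rewrite big_mkcond; apply: enorm_mean_le => // j.
by case: ifP => // _; rewrite enorm0.
Qed.

Let dev_le i : (i <= n)%N -> dev i <= eta * B.
Proof.
move=> i_n; rewrite /dev loopE// enormN enormZ gtr0_norm// ler_pM2l//.
exact: partial_le.
Qed.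

Let dev_ge0 i : 0 <= dev i. Proof. exact: enorm_ge0. Qed.

Let meandev_ge0 : 0 <= meandev.
Proof. by rewrite mulr_ge0 ?invr_ge0// sumr_ge0. Qed.

Let meandev_le : meandev <= eta * B.
Proof.
rewrite /meandev ler_pdivrMl ?ltr0n// mulr_natl -[in leRHS](card_ord n) -sumr_const.
by apply: ler_sum => j _; rewrite dev_le// ltnW.
Qed.

(** [Option2] has no error. For [Option1], the components not yet refreshed cancel against those of
    the mean, reindexed by [pi]. *)
Let F_estimate_le i :
  enorm (F_estimate D o pi w i - Fmean D (w 0%N)) <= MF D * meandev.
Proof.
case: o => /=; last by rewrite subrr enorm0 mulr_ge0 ?MF_ge0.
have -> : Fmean D (w 0%N) = n%:R^-1 *: \sum_(j < n) F_ D (pi j) (w 0%N).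
  by rewrite /Fmean (reindex_inj (@perm_inj _ pi)).
rewrite [\sum_(j < n) _](bigID (fun j : 'I_n => (j <= i)%N)) /=.
under [X in _ - _ *: (_ + X)]eq_bigl do rewrite -ltnNge.
rewrite -scalerBr opprD addrACA subrr addr0 -sumrB enormZ ger0_norm ?invr_ge0//.
rewrite /meandev mulrCA ler_wpM2l ?invr_ge0// mulr_sumr.
apply: le_trans (enorm_sum_le _ _ _) _.
rewrite [leRHS](bigID (fun j : 'I_n => (j <= i)%N)) /= -[leLHS]addr0 lerD//.
  by apply: ler_sum => j _; exact: (F_lipschitz_MF HA).
by apply: sumr_ge0 => j _; rewrite mulr_ge0 ?MF_ge0.
Qed.

(** The difference of products is split into the motion of the Jacobian and that of the maximizer;
    the constants are the two terms of [smoothness]. *)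
Let gh_error i : enorm (gh i - a (pih i)) <=
  LF D * (opnorm (K_ D) * Mh) * dev i
  + MF D ^+ 2 * opnorm (K_ D) ^+ 2 / (muh + gamma) * meandev.
Proof.
rewrite /gh /a /component_grad.
set u := ustar _ _ (F_estimate _ _ _ _ _); set u0 := ustar _ _ (Fmean _ _).
set J := jac _ (w i); set J0 := jac _ (w 0%N).
have -> : u *m (K_ D)^T *m J - u0 *m (K_ D)^T *m J0 =
    u *m (K_ D)^T *m (J - J0) + (u - u0) *m (K_ D)^T *m J0.
  by rewrite mulmxBr !mulmxBl addrA subrK.
apply: le_trans (enormD_le _ _) _; apply: lerD.
  apply: le_trans (enorm_mulmx_le _ _) _; rewrite mulrAC; apply: ler_pM.
  - exact: opnorm_ge0.
  - exact: enorm_ge0.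
  - exact: (jac_lipschitz_LF HA).
  - exact: (enorm_Kustar_le HA).
apply: le_trans (enorm_mulmx_le _ _) _.
rewrite (_ : _ / _ * meandev = MF D * (opnorm (K_ D) *
  (opnorm (K_ D) / (muh + gamma) * (MF D * meandev)))); last by ring.
apply: ler_pM; rewrite ?opnorm_ge0 ?enorm_ge0 ?(opnorm_jacF_le HA)//.
apply: le_trans (enorm_mulmxT_le _ _) _; rewrite ler_wpM2l ?opnorm_ge0//.
apply: le_trans (ustar_lipschitz HA gamma0 sigma0 _ _) _.
by rewrite ler_wpM2l// divr_ge0 ?opnorm_ge0// ltW.
Qed.

Let error := n%:R^-1 *: \sum_i gh i - gradPhi D gamma (w 0%N).

Let gradPhi_perm : gradPhi D gamma (w 0%N) = n%:R^-1 *: \sum_i a (pih i).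
Proof. 
have <- : \sum_i a i = \sum_i a (pih i) by exact: (reindex_inj (@perm_inj _ pih)).
exact: (gradPhiE HA gamma0 sigma0 n0).
Qed.

(** Averaging [gh_error] over [i] turns [dev i] into [meandev] too, so the two constants add up to
    [L]. *)
Let error_le_meandev : enorm error <= L * meandev.
Proof.
rewrite /error gradPhi_perm -scalerBr -sumrB enormZ ger0_norm ?invr_ge0//.
rewrite ler_pdivrMl ?ltr0n//; apply: le_trans (enorm_sum_le _ _ _) _.
apply: le_trans (ler_sum _ (fun i _ => gh_error i)) _.
rewrite big_split /= -mulr_sumr sumr_const card_ord -[_ *+ n]mulr_natl.
have -> : \sum_(i < n) dev i = n%:R * meandev.
  by rewrite mulrA [n%:R * _]mulrC mulVn1// mul1r.
rewrite /L /smoothness; set x := LF D * _; set y := _ / _; lra.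
Qed.

(** The first bound only uses that inner steps are bounded and serves arbitrary permutations; the
    second keeps the partial means, whose average over permutations is small. *)
Lemma epoch_error : { e : 'rV[R]_p | [/\
  w n = w 0%N - eta *: (gradPhi D gamma (w 0%N) + e),
  enorm e <= L * (eta * B) &
  enorm e ^+ 2 <= 2 * L ^+ 2 * eta ^+ 2 *
    (n%:R^-1 * \sum_(i < n) enorm (partial_mean i) ^+ 2 + (L * (eta * B)) ^+ 2)] }.
Proof.
have LB_ge0 : 0 <= L * (eta * B).
  by apply: mulr_ge0 => //; apply: mulr_ge0 => //; exact: ltW.
exists error; split.
- rewrite /error [gradPhi _ _ _ + _]addrC subrK.
  have := loopE (leqnn n); rewrite (eq_bigl predT) => [h|j]; last exact: ltn_ord.
  by rewrite -h addrC subrK.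
- by apply: (le_trans error_le_meandev); rewrite ler_wpM2l.
(* Bootstrapping: replacing each [gh j] by the component gradient at the start of the epoch costs at
   most [L * (eta * B)], by [gh_error] and the crude bound on [dev]. *)
have devS (i : 'I_n) : dev i <= eta * (enorm (partial_mean i) + L * (eta * B)).
  rewrite /dev loopE 1?ltnW// enormN enormZ gtr0_norm// ler_pM2l//.
  have -> : n%:R^-1 *: \sum_(j < n | (j < i)%N) gh j = partial_mean i +
      n%:R^-1 *: \sum_(j < n | (j < i)%N) (gh j - a (pih j)).
    rewrite /partial_mean -scalerDr -big_split /=.
    by rewrite (eq_bigr _ (fun j _ => esym (subrKC (a (pih j)) (gh j)))).
  apply: le_trans (enormD_le _ _) _; rewrite lerD2l; apply: partial_le => //.
  move=> j; apply: (le_trans (gh_error j)); rewrite /L /smoothness mulrDl lerD//.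
    rewrite ler_wpM2l ?mulr_ge0 ?LF_ge0 ?opnorm_ge0 ?(Mh_ge0 HA gamma0 sigma0)//.
    by rewrite dev_le// ltnW.
  by rewrite ler_wpM2l// divr_ge0 ?(ltW sigma0)// mulr_ge0 ?sqr_ge0.
apply: (@le_trans _ _ (L ^+ 2 * meandev ^+ 2)).
  by rewrite -exprMn lerXn2r ?nnegrE ?enorm_ge0//; exact: mulr_ge0.
rewrite [2 * _]mulrC -[leRHS]mulrA -[leRHS]mulrA ler_wpM2l ?sqr_ge0//.
apply: le_trans (sqr_mean_le _ n0) _.
have -> : 2 * (eta ^+ 2 *
    (n%:R^-1 * \sum_(i < n) enorm (partial_mean i) ^+ 2 + (L * (eta * B)) ^+ 2)) =
  n%:R^-1 * \sum_(i < n)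
    (2 * eta ^+ 2 * (enorm (partial_mean i) ^+ 2 + (L * (eta * B)) ^+ 2)).
  rewrite -mulr_sumr big_split /= sumr_const card_ord -[_ *+ n]mulr_natl.
  by field; rewrite pnatr_eq0 -lt0n.
rewrite ler_wpM2l ?invr_ge0//; apply: ler_sum => i _.
apply: (@le_trans _ _ (eta ^+ 2 * (enorm (partial_mean i) + L * (eta * B)) ^+ 2)).
  rewrite -exprMn lerXn2r ?nnegrE ?mulr_ge0 ?addr_ge0 ?enorm_ge0 ?(ltW eta0)//.
rewrite -[leRHS]mulrA [leRHS]mulrCA ler_wpM2l ?sqr_ge0//.
set x := enorm _; set y := L * _; have := sqr_ge0 (x - y); lra.
Qed.

End Epoch.

(** * The whole run *)

(** There are [T] steps but [T.+1] summands; the second hypothesis provides for the last one. *)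
Lemma telescope_le (R : realType) (T : nat) (s a : nat -> R) (c d lo : R) :
  (forall t, (t < T)%N -> s t.+1 + c * a t <= s t + d) ->
  lo + c * a T <= s T ->
  c * \sum_(0 <= t < T.+1) a t <= s 0%N - lo + T%:R * d.
Proof.
move=> step last.
suff H t : (t <= T)%N -> s t + c * \sum_(0 <= i < t) a i <= s 0%N + t%:R * d.
  by have := H T (leqnn T); rewrite big_nat_recr//= mulrDr; lra.
elim: t => [|t IH] tT; first by rewrite big_geq// mulr0 mul0r.
have := IH (ltnW tT); have := step t tT.
by rewrite big_nat_recr//= mulrDr -[t.+1%:R]natr1; lra.
Qed.

(* [s] stands for the square root of the variance reduction factor: [1] for
   arbitrary permutations and [sqrt n] for random ones. *)
Lemma rate_le (R : realType) (T : nat) (S Delta E s eps : R) :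
  0 <= E -> 0 < s -> 0 < eps ->
  let c := (4 * (1 + E))^-1 in
  let eta := c * s * eps in
  16 * (`|Delta| + 1) / c * s^-1 * eps ^- 3 <= T%:R ->
  eta / 8 * S <= Delta + T%:R * (eta ^+ 3 * E / s ^+ 2) ->
  T.+1%:R^-1 * S <= eps ^+ 2.
Proof.
move=> E0 s0 e0 c eta hT hS.
have E1 : 0 < 4 * (1 + E) by lra.
have c0 : 0 < c by rewrite invr_gt0.
have eta0 : 0 < eta by rewrite !mulr_gt0.
have T1 : 0 < T.+1%:R :> R by rewrite ltr0n.
rewrite ler_pdivrMl// -(ler_pM2l (_ : 0 < eta / 8)); last by rewrite divr_gt0.
apply: (le_trans hS).
(* The error takes half of the target [eps ^+ 2]: the choice of [c] gives [c ^+ 2 * E <= 1 / 16]. *)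
have hE : eta ^+ 3 * E / s ^+ 2 <= eta / 8 * (eps ^+ 2 / 2).
  have -> : eta ^+ 3 * E / s ^+ 2 = eta * eps ^+ 2 * (c ^+ 2 * E).
    by rewrite /eta; field; rewrite gt_eqF.
  have -> : eta / 8 * (eps ^+ 2 / 2) = eta * eps ^+ 2 * (1 / 16) by field.
  rewrite ler_pM2l ?mulr_gt0 ?exprn_gt0//.
  rewrite /c exprVn mulrC ler_pdivrMr ?exprn_gt0//.
  have := sqr_ge0 E; lra.
(* The initial gap takes the other half, since [T%:R * (c * s * eps ^+ 3) / 16] is at least
   [|Delta| + 1]. *)
have hD : Delta <= T%:R * (eta / 8 * (eps ^+ 2 / 2)).
  apply: (@le_trans _ _ (`|Delta| + 1)); first by have := ler_norm Delta; lra.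
  have x0 : 0 < eta / 8 * (eps ^+ 2 / 2) by rewrite mulr_gt0 ?divr_gt0 ?exprn_gt0.
  apply: le_trans (ler_wpM2r (ltW x0) hT).
  rewrite le_eqVlt; apply/orP; left; apply/eqP; rewrite /eta.
  by field; rewrite !gt_eqF.
rewrite -[T.+1%:R]natr1.
have := ler_wpM2l (ler0n R T) hE.
have : 0 < eta / 8 * eps ^+ 2 by rewrite mulr_gt0 ?divr_gt0 ?exprn_gt0.
set x := T%:R * (eta ^+ 3 * _ / _).
rewrite (_ : eta / 8 * ((T%:R + 1) * eps ^+ 2) =
  T%:R * (eta / 8 * (eps ^+ 2 / 2)) * 2 + eta / 8 * eps ^+ 2); last by field.
move: hD; set y := T%:R * (eta / 8 * _); lra.
Qed.

Section Run.
Variables (R : realType) (n p q m : nat) (D : minimax R n p q m).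
Variables (muh Mh sigmaJ gamma : R).
Hypothesis HA : standing_assumptions D muh Mh sigmaJ.
Hypotheses (gamma0 : 0 <= gamma) (sigma0 : 0 < muh + gamma).

(** * Comparison of the smoothed and original objective gaps *)

Section Gap.
Variables (wt0 : 'rV[R]_p) (Delta supb : R).
Hypothesis start : edom (Psi D 0) wt0.
Hypothesis DeltaE : (Psi D 0 wt0 - Psi0_star D)%E = Delta%:E.
Hypothesis supbE : ereal_sup [set `|b_ D u|%:E | u in edom (h_ D)] = supb%:E.

Let b_le u : edom (h_ D) u -> `|b_ D u| <= supb.
Proof. by move=> du; rewrite -lee_fin -supbE; apply: ereal_sup_ubound; exists u. Qed.

Let phi0_le v : (phi D 0 v <= (fine (phi D gamma v) + gamma * supb)%:E)%E.
Proof.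
apply: ub_ereal_sup => _ [u _ <-]; rewrite /smoothed_obj mul0r sube0.
have hu0 := (h_proper HA).1 u.
case hu : (h_ D u) hu0 => [r||]// _; last by rewrite /= leNye.
have du : edom (h_ D) u by rewrite /edom /= hu ltry.
have := phi_ge HA gamma0 sigma0 v du; rewrite hu /= -EFinB lee_fin.
have := ler_wpM2l gamma0 (le_trans (ler_norm _) (b_le du)).
have : 0 <= (muh + gamma) / 2 * enorm (u - ustar D gamma v) ^+ 2.
  by rewrite mulr_ge0 ?sqr_ge0// divr_ge0// ltW.
lra.
Qed.

Let phi0_ge v : ((fine (phi D gamma v) - gamma * supb)%:E <= phi D 0 v)%E.
Proof.
have du := ustar_dom HA gamma0 sigma0 v.
apply: (@le_trans _ _ (smoothed_obj D 0 v (ustar D gamma v))); last first.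
  by apply: ereal_sup_ubound; exists (ustar D gamma v).
rewrite (phiE HA gamma0 sigma0) /smoothed_obj mul0r sube0 /=.
have hu0 := (h_proper HA).1 (ustar D gamma v).
move: du; rewrite /edom /=.
case hu : (h_ D _) hu0 => [r||]// _ _; rewrite -EFinB lee_fin.
have du : edom (h_ D) (ustar D gamma v) by rewrite /edom /= hu ltry.
have := ler_wpM2l gamma0 (b_le du).
have := ler_wpM2l gamma0 (ler_norm (- b_ D (ustar D gamma v))).
by rewrite normrN /=; lra.
Qed.

(** Smoothing shifts the objective by at most [gamma * supb] in either direction; the starting value
    and the lower bound each contribute one such shift. *)
Lemma psi_gap : exists lo a, [/\ f_ D wt0 = a%:E,
  psi D gamma wt0 - lo <= Delta + 2 * (gamma * supb) &
  forall x c, f_ D x = c%:E -> lo <= psi D gamma x].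
Proof.
have phi0_fin v : exists r, phi D 0 v = r%:E.
  have := phi0_le v; have := phi0_ge v.
  by case: (phi D 0 v) => [r||]//; exists r.
have inf_le x : (Psi0_star D <= Psi D 0 x)%E.
  by apply: ereal_inf_lbound; exists x.
move: (inf_le wt0) DeltaE start (Psi0_bounded_below HA).
have [r0 r0E] := phi0_fin (Fmean D wt0).
case s0E : (Psi0_star D) => [s0||]//; last first.
  by rewrite leye_eq => /eqP; rewrite /edom /= => ->.
rewrite /edom /= {1 2 3}/Psi /Phi r0E.
case fE : (f_ D wt0) ((f_proper HA).1 wt0) => [a||]// _ _ [dE] _ _.
exists (s0 - gamma * supb), a; split => //.
  rewrite /psi fE /= /Phi; have := phi0_ge (Fmean D wt0); rewrite r0E lee_fin; lra.
move=> x c fx; have := inf_le x; rewrite s0E /Psi /Phi /psi fx.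
have [r rE] := phi0_fin (Fmean D x).
have := phi0_le (Fmean D x); rewrite rE -EFinD !lee_fin /= /Phi; lra.
Qed.

End Gap.

(** Strong induction, because the estimate of [Option1] reads all earlier inner iterates. Agreement
    holds up to index [n], beyond which the loop leaves [w] unconstrained. *)
Lemma inner_loop_unique o (eta : R) (pi pih : 'S_n) (w w' : nat -> 'rV[R]_p) :
  w 0%N = w' 0%N -> inner_loop D o gamma eta pi pih w ->
  inner_loop D o gamma eta pi pih w' -> forall i, (i <= n)%N -> w i = w' i.
Proof.
move=> w0 lw lw'; elim/ltn_ind => -[//|i] IH i_n.
have := lw (Ordinal i_n); have := lw' (Ordinal i_n) => /= -> ->.
suff -> : F_estimate D o pi w (Ordinal i_n) = F_estimate D o pi w' (Ordinal i_n).
  by rewrite IH// ltnW.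
case: o {lw lw'} => /=; last by rewrite w0.
rewrite w0; congr (_ *: (_ + _)); apply: eq_bigr => j ji.
by rewrite IH// ltnW.
Qed.

(** The iterate [wt t] depends only on the permutations of the epochs before [t]: this makes it
    independent of the permutations drawn next. *)
Lemma run_unique o (T : nat) (eta : 'I_T -> R) (pi pih pi' pih' : 'I_T -> 'S_n)
    (wt0 : 'rV[R]_p) (wt wt' : nat -> 'rV[R]_p) (t : nat) : (t <= T)%N ->
  algorithm1_run D o gamma eta pi pih wt0 wt ->
  algorithm1_run D o gamma eta pi' pih' wt0 wt' ->
  (forall s : 'I_T, (s < t)%N -> pi s = pi' s /\ pih s = pih' s) ->
  wt t = wt' t.
Proof.
move=> tT [w0 run] [w0' run'] same; elim: t tT same => [|t IH] tT same.
  by rewrite w0 w0'.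
have [w [w00 lw ->]] := run (Ordinal tT).
have [w' [w00' lw' ->]] := run' (Ordinal tT).
have [pE phE] := same (Ordinal tT) (ltnSn _); rewrite -pE -phE in lw'.
rewrite (inner_loop_unique _ lw lw')// w00 w00' /= IH ?(ltnW tT)// => s st.
by apply: same; exact: ltnW.
Qed.

Hypothesis n0 : (0 < n)%N.
Variables (eta : R) (o : estimator) (T : nat) (pi pih : 'I_T -> 'S_n).
Variables (wt0 : 'rV[R]_p) (wt : nat -> 'rV[R]_p) (a0 : R).
Hypotheses (eta0 : 0 < eta) (Leta : 4 * smoothness D muh Mh gamma * eta <= 1).
Hypothesis f0 : f_ D wt0 = a0%:E.
Hypothesis run : algorithm1_run D o gamma (fun=> eta) pi pih wt0 wt.

Let L := smoothness D muh Mh gamma.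
Let B := grad_bound D Mh.

Lemma run_dom t : (t <= T)%N -> exists a, f_ D (wt t) = a%:E.
Proof.
case: run => w0 run'; case: t => [_|t tT]; first by exists a0; rewrite w0.
have [w [_ _ ->]] := run' (Ordinal tT).
exact: prox_dom (f_proper HA) (f_closed HA) (f_convex HA) eta0 _.
Qed.

Lemma run_step (t : 'I_T) :
  let prog := psi D gamma (wt t.+1) +
    eta / 4 * enorm (gradient_mapping D gamma eta (wt t)) ^+ 2 in
  prog <= psi D gamma (wt t) + 3 / 2 * eta * (L * (eta * B)) ^+ 2 /\
  prog <= psi D gamma (wt t) + 3 / 2 * eta * (2 * L ^+ 2 * eta ^+ 2 *
    (n%:R^-1 * \sum_(i < n) enorm (n%:R^-1 *:
       \sum_(j < n | (j < i)%N) component_grad D gamma (pih t j) (wt t)) ^+ 2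
     + (L * (eta * B)) ^+ 2)).
Proof.
have [a fa] := run_dom (ltnW (ltn_ord t)).
case: run => _ /(_ t) [w [w0 lw wE]] prog.
have [e [eE e1 e2]] := epoch_error HA gamma0 sigma0 n0 eta0 lw.
have := prox_step HA gamma0 sigma0 n0 eta0 e Leta fa.
rewrite -w0 -eE -wE w0 -/prog => h; rewrite /partial_mean w0 in e2.
have c0 : 0 <= 3 / 2 * eta by rewrite mulr_ge0// ltW.
split; apply: (le_trans h); rewrite lerD2l ler_wpM2l//.
by rewrite lerXn2r ?nnegrE ?enorm_ge0// (le_trans (enorm_ge0 e)).
Qed.

(** An exact proximal step, with [e = 0], from the last iterate lands where [f_ D] is finite, hence
    where [psi] is at least [lo]. *)
Lemma run_last lo : (forall x c, f_ D x = c%:E -> lo <= psi D gamma x) ->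
  lo + eta / 4 * enorm (gradient_mapping D gamma eta (wt T)) ^+ 2 <= psi D gamma (wt T).
Proof.
move=> hlo; have [a fa] := run_dom (leqnn T).
have := prox_step HA gamma0 sigma0 n0 eta0 0 Leta fa.
rewrite enorm0 expr0n /= mulr0 !addr0; move=> h; apply: le_trans h; rewrite lerD2r.
have [c fc] := prox_dom (f_proper HA) (f_closed HA) (f_convex HA) eta0
  (wt T - eta *: gradPhi D gamma (wt T)).
exact: hlo fc.
Qed.

End Run.

(** * Finite expectations *)

Section FiniteExpectation.
Variables (R : realType) (d : measure_display) (Om : measurableType d).
Variable (P : probability Om R).

(** The composite is a nonnegative combination of the indicators of the fibres of [Y]. *)
Lemma expectation_finite (F : finType) (Y : Om -> F) (g : F -> R) :
  (forall y, measurable (Y @^-1` [set y])) -> (forall y, 0 <= g y) ->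
  ('E_P[g \o Y] = \sum_y (g y)%:E * P (Y @^-1` [set y]))%E.
Proof.
move=> mY g0; rewrite unlock.
transitivity (\int[P]_om (\sum_y (g y * \1_(Y @^-1` [set y]) om)%:E))%E.
  apply: eq_integral => om _; rewrite sumEFin (bigD1 (Y om))//= big1 => [|y yY].
    by rewrite indicE mem_set// mulr1 addr0.
  by rewrite indicE memNset ?mulr0//= => /esym/eqP; rewrite (negbTE yY).
rewrite ge0_integral_sum//.
- apply: eq_bigr => y _; rewrite (@integralZl_indic _ _ _ _ _ _ (fun=> Y @^-1` [set y]))//.
    by rewrite integral_indic// setIT.
  by rewrite ltNge g0.
- by move=> y; apply/measurable_EFinP; apply: measurable_funM => //; exact: measurable_indic.
- by move=> y om _; rewrite lee_fin mulr_ge0.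
Qed.

Variables (I S : finType) (X : I -> Om -> S).
Hypotheses (Xd : forall i, discrete_rv (X i)) (Xu : forall i, uniform_rv P (X i)).
Hypothesis Xi : mutually_independent P X.

(** Gathering all the variables in one finite-valued map; independence and uniformity make its law
    uniform. *)
Definition joint (om : Om) : {ffun I -> S} := [ffun i => X i om].

Let joint_preimage x : joint @^-1` [set x] =
  \bigcap_(i in [set` [set: I]%SET]) (X i @^-1` [set x i]).
Proof.
apply/seteqP; split=> om /=.
  by move=> <- i _ /=; rewrite ffunE.
move=> h; apply/ffunP => i; rewrite ffunE.
by apply: h; rewrite /= inE.
Qed.

Let joint_measurable x : measurable (joint @^-1` [set x]).
Proof.
rewrite joint_preimage; apply: fin_bigcap_measurable => // i _; exact: Xd.
Qed.

Let joint_uniform x : P (joint @^-1` [set x]) = (#|{ffun I -> S}|%:R^-1)%:E.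
Proof.
rewrite joint_preimage Xi (eq_bigr (fun=> (#|S|%:R^-1)%:E)) => [|i _]; last exact: Xu.
by rewrite prodEFin prodr_const card_ffun cardsT natrX exprVn.
Qed.

(** Each tuple has positive probability, so its fibre is not empty. *)
Lemma joint_surjective x : exists om, joint om = x.
Proof.
apply: contrapT => h; have := joint_uniform x.
rewrite (_ : _ @^-1` _ = set0); last first.
  by apply/seteqP; split => // om /= xE; apply: h; exists om.
rewrite measure0 => -[/esym/eqP]; rewrite invr_eq0 pnatr_eq0 => /eqP/card0_eq.
by move=> /(_ x).
Qed.

Lemma expectation_joint (g : {ffun I -> S} -> R) : (forall x, 0 <= g x) ->
  ('E_P[g \o joint] = (#|{ffun I -> S}|%:R^-1 * \sum_x g x)%:E)%E.
Proof.
move=> g0; rewrite expectation_finite// (eq_bigr (fun x =>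
  (g x * #|{ffun I -> S}|%:R^-1)%:E)) => [|x _].
  by rewrite sumEFin -mulr_suml mulrC.
by rewrite joint_uniform.
Qed.

End FiniteExpectation.

(* Multiplying the [j]-th coordinate by a fixed group element permutes the
   sample space; averaging over that element resamples the coordinate. *)
Lemma resample_coordinate (R : realType) (I : finType) (gT : finGroupType)
    (j : I) (g : {ffun I -> gT} -> gT -> R) :
  (forall (x y : {ffun I -> gT}) s, (forall i, i != j -> x i = y i) -> g x s = g y s) ->
  \sum_x g x (x j) = \sum_x #|gT|%:R^-1 * \sum_s g x s.
Proof.
move=> g_off; have N0 : #|gT|%:R != 0 :> R.
  by rewrite pnatr_eq0 -lt0n; apply/card_gt0P; exists 1%g.
pose upd (t : gT) (x : {ffun I -> gT}) :=
  [ffun i => if i == j then (x i * t)%g else x i].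
have upd_inj t : injective (upd t).
  move=> x y /ffunP xy; apply/ffunP => i; have := xy i.
  by rewrite !ffunE; case: eqP => // _ /mulIg.
have shift t : \sum_x g x (x j) = \sum_x g x (x j * t)%g.
  rewrite (reindex_inj (upd_inj t)); apply: eq_bigr => x _.
  rewrite [X in g _ X]ffunE eqxx; apply: g_off => i ij.
  by rewrite ffunE (negbTE ij).
rewrite -mulr_sumr; apply: (mulfI N0); rewrite mulrA mulfV// mul1r.
rewrite mulr_natl -sumr_const; under eq_bigr => t _ do rewrite (shift t).
rewrite exchange_big; apply: eq_bigr => x _.
by rewrite [RHS](reindex_inj (mulgI (x j))).
Qed.

(** * Random permutations *)

Section Mean.
Variables (R : realType) (X : finType).
Implicit Types g h : X -> R.

Definition mean g : R := #|X|%:R^-1 * \sum_x g x.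

Lemma mean_le g h : (forall x, g x <= h x) -> mean g <= mean h.
Proof. by move=> gh; rewrite ler_wpM2l ?invr_ge0// ler_sum. Qed.

Lemma meanD g h : mean (fun x => g x + h x) = mean g + mean h.
Proof. by rewrite /mean big_split mulrDr. Qed.

Lemma meanZ c g : mean (fun x => c * g x) = c * mean g.
Proof. by rewrite /mean -mulr_sumr mulrCA. Qed.

Lemma mean_sum (I : finType) (g : I -> X -> R) :
  mean (fun x => \sum_i g i x) = \sum_i mean (g i).
Proof. by rewrite /mean exchange_big mulr_sumr. Qed.

Lemma mean_cst (x0 : X) c : mean (fun=> c) = c.
Proof.
rewrite /mean sumr_const -[c *+ _]mulr_natl mulrA mulVf ?mul1r// pnatr_eq0 -lt0n.
by apply/card_gt0P; exists x0.
Qed.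

End Mean.

(** The finite form of conditioning on all the coordinates but [j]. *)
Lemma mean_resample (R : realType) (I : finType) (gT : finGroupType) (j : I)
    (g : {ffun I -> gT} -> gT -> R) :
  (forall (x y : {ffun I -> gT}) s, (forall i, i != j -> x i = y i) -> g x s = g y s) ->
  mean (fun x => g x (x j)) = mean (fun x => mean (g x)).
Proof. by move=> g_off; rewrite /mean (resample_coordinate g_off). Qed.

(** * Descent in mean over all tuples of permutations *)

Section RandomRun.
Variables (R : realType) (n p q m : nat) (D : minimax R n p q m).
Variables (muh Mh sigmaJ gamma eta Lambda0 Lambda1 : R) (o : estimator) (T : nat).
Hypothesis HA : standing_assumptions D muh Mh sigmaJ.
Hypotheses (gamma0 : 0 <= gamma) (sigma0 : 0 < muh + gamma).
Hypotheses (n0 : (0 < n)%N) (eta0 : 0 < eta).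
Hypothesis growth : gradient_growth D gamma eta Lambda0 Lambda1.

Let L := smoothness D muh Mh gamma.
Let B := grad_bound D Mh.
Let Om : finType := {ffun 'I_T * bool -> 'S_n}.

Variables (wt0 : 'rV[R]_p) (W : Om -> nat -> 'rV[R]_p) (a0 lo : R).
Hypothesis f0 : f_ D wt0 = a0%:E.
Hypothesis run : forall x : Om, algorithm1_run D o gamma (fun=> eta)
  (fun t => x (t, true)) (fun t => x (t, false)) wt0 (W x).
Hypothesis psi_ge : forall x c, f_ D x = c%:E -> lo <= psi D gamma x.
Hypotheses (Leta : 4 * L * eta <= 1) (Leta2 : 48 * (L ^+ 2 * Lambda0) * eta ^+ 2 <= 1).
Hypothesis LBeta : L ^+ 2 * B ^+ 2 * n%:R * eta ^+ 2 <= 1.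

Let sqG t (x : Om) := enorm (gradient_mapping D gamma eta (W x t)) ^+ 2.
Let Psi_ t (x : Om) := psi D gamma (W x t).
Let pmean i (s : 'S_n) (w : 'rV[R]_p) : R :=
  enorm (n%:R^-1 *: \sum_(j < n | (j < i)%N) component_grad D gamma (s j) w) ^+ 2.

Let x0 : Om := [ffun=> 1%g].

(** The iterate [W x t] does not involve the coordinate [(t, false)], which can thus be resampled
    with the iterate held fixed; the estimate for sampling without replacement and the growth
    condition then apply. *)
Let mean_pmean_le (t : 'I_T) (i : 'I_n) :
  mean (fun x : Om => pmean i (x (t, false)) (W x t)) <=
  2 * Lambda0 * mean (sqG t) + (2 * Lambda1 + 2 * B ^+ 2 / n%:R).
Proof.
rewrite -meanZ -(mean_cst x0 (2 * Lambda1 + _)) -meanD.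
rewrite (mean_resample (g := fun x s => pmean i s (W x t))); last first.
  move=> x y s xy; rewrite (run_unique (t := t) _ (run x) (run y))//.
    exact: ltnW.
  by move=> u ut; split; apply: xy; rewrite xpair_eqE -val_eqE /= ltn_eqF.
apply: mean_le => x; rewrite /mean card_Sn.
apply: (le_trans (mean_perm_partial_mean_le n0 (ltnW (ltn_ord i))
  (fun l => component_grad_le HA gamma0 sigma0 l (W x t)))).
rewrite -(gradPhiE HA gamma0 sigma0 n0) addrA lerD2r.
by have := growth (W x t); rewrite /sqG; lra.
Qed.

Let mean_step (t : 'I_T) : mean (Psi_ t.+1) + eta / 4 * mean (sqG t) <=
  mean (Psi_ t) + 3 / 2 * eta * (2 * L ^+ 2 * eta ^+ 2 *
    (2 * Lambda0 * mean (sqG t) + (2 * Lambda1 + 2 * B ^+ 2 / n%:R)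
     + (L * (eta * B)) ^+ 2)).
Proof.
pose bound (x : Om) := 3 / 2 * eta * (2 * L ^+ 2 * eta ^+ 2 *
  (n%:R^-1 * (\sum_(i < n) pmean i (x (t, false)) (W x t)) + (L * (eta * B)) ^+ 2)).
have := @mean_le _ _ (fun x => Psi_ t.+1 x + eta / 4 * sqG t x)
  (fun x => Psi_ t x + bound x)
  (fun x => (run_step HA gamma0 sigma0 n0 eta0 Leta f0 (run x) t).2).
rewrite !meanD meanZ => /le_trans; apply.
rewrite lerD2l /bound !meanZ ler_wpM2l ?mulr_ge0 ?(ltW eta0)//.
rewrite ler_wpM2l//; first by rewrite mulr_ge0 ?sqr_ge0// mulr_ge0 ?sqr_ge0.
rewrite meanD (mean_cst x0) lerD2r meanZ mean_sum.
move: (mean_pmean_le t); set c := 2 * Lambda0 * _ + _ => mean_c.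
rewrite ler_pdivrMl ?ltr0n// mulr_natl -[in leRHS](card_ord n) -sumr_const.
by apply: ler_sum => i _; exact: mean_c.
Qed.

Lemma random_descent (E : R) :
  3 * L ^+ 2 * (2 * (n%:R * Lambda1) + 2 * B ^+ 2 + 1) <= E ->
  eta / 8 * \sum_(0 <= t < T.+1) mean (sqG t) <=
  psi D gamma wt0 - lo + T%:R * (eta ^+ 3 * E / n%:R).
Proof.
move=> hE; have nR : 0 < n%:R :> R by rewrite ltr0n.
have sqG0 t : 0 <= mean (sqG t).
  by rewrite -(mean_cst x0 0); apply: mean_le => x; exact: sqr_ge0.
have eta8 t : 0 <= eta / 8 * mean (sqG t) by rewrite mulr_ge0 ?divr_ge0 ?(ltW eta0).
have -> : psi D gamma wt0 = mean (Psi_ 0%N).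
  rewrite -(mean_cst x0 (psi D gamma wt0)); congr mean; apply/funext => x.
  by rewrite /Psi_ (run x).1.
apply: (telescope_le (s := fun t => mean (Psi_ t)) (a := fun t => mean (sqG t)))
  => [t tT|]; last first.
  have := @mean_le _ _ (fun x => lo + eta / 4 * sqG T x) (Psi_ T)
    (fun x => run_last HA gamma0 sigma0 n0 eta0 Leta f0 (run x) psi_ge).
  by rewrite meanD (mean_cst x0) meanZ; have := eta8 T; rewrite /Psi_ /sqG; lra.
have := mean_step (Ordinal tT) => /=.
set g := mean (sqG t); set s1 := mean _; set s2 := mean _ => h.
have g0 : 0 <= g := sqG0 t.
(* The coefficient of [g] in the error is [6 * L ^+ 2 * Lambda0 * eta ^+ 3], at most [eta / 8]: half
   of the decrease absorbs it. *)
have h1 : eta * g * (48 * (L ^+ 2 * Lambda0) * eta ^+ 2) <= eta * g.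
  by rewrite ler_piMr// mulr_ge0 ?(ltW eta0).
(* [LBeta] brings the drift of the inner iterates down to the [1 / n] order of the sampling
   variance. *)
have h2 : (L * (eta * B)) ^+ 2 <= n%:R^-1.
  by rewrite -(ler_pM2l nR) mulfV ?gt_eqF//; move: LBeta; rewrite !exprMn; lra.
have h3 : 3 * eta ^+ 3 * L ^+ 2 * (2 * Lambda1 + 2 * B ^+ 2 / n%:R + (L * (eta * B)) ^+ 2)
    <= eta ^+ 3 * E / n%:R.
  apply: (@le_trans _ _ (eta ^+ 3 *
      (3 * L ^+ 2 * (2 * (n%:R * Lambda1) + 2 * B ^+ 2 + 1)) / n%:R)); last first.
    by rewrite ler_pM2r ?invr_gt0// ler_pM2l ?exprn_gt0.
  rewrite [leRHS](_ : _ = 3 * eta ^+ 3 * L ^+ 2 *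
    (2 * Lambda1 + 2 * B ^+ 2 / n%:R + n%:R^-1)); last by field; rewrite gt_eqF.
  by rewrite ler_wpM2l ?lerD2l// mulr_ge0 ?sqr_ge0// mulr_ge0// exprn_ge0// ltW.
move: h h1 h3; set x := _ / n%:R; set y := (L * _) ^+ 2; set z := _ / n%:R.
lra.
Qed.

End RandomRun.

(** * Choice of the constants and conclusion *)

Lemma near0_small (R : realType) (K : R) : 0 < K ->
  \forall e \near 0^'+, 0 < e /\ K * e <= 1.
Proof.
move=> K0; near=> e.
have e0 : 0 < e by near: e; exact: nbhs_right_gt.
split => //; rewrite mulrC -ler_pdivlMr// mul1r.
by near: e; apply: nbhs_right_le; rewrite invr_gt0.
Unshelve. all: by end_near. Qed.

Lemma le_natceil (R : realType) (x : R) : 0 <= x -> x <= `|Num.ceil x|%N%:R.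
Proof.
move=> x0; apply: le_trans (ceil_ge x) _.
by rewrite natr_absz ler_int ler_norm.
Qed.

Theorem theorem1 (R : realType)
    (muh gamma Mh normK mF lF sigmaJ Lambda0 Lambda1 Delta supb : R) :
  0 <= gamma -> 0 < muh + gamma -> 1 <= Lambda0 -> 0 <= Lambda1 ->
  (exists c C : R, [/\ 0 < c, 0 < C &
    \forall eps \near 0^'+,
    forall (n p q m : nat) (D : minimax R n p q m) (wt0 : 'rV[R]_p)
      (o : estimator),
    let eta := c * eps in
    let T := `|Num.ceil (C * eps ^- 3)|%N in
    (0 < n)%N ->
    has_constants D wt0 muh gamma Mh normK mF lF sigmaJ Delta supb ->
    gradient_growth D gamma eta Lambda0 Lambda1 ->
    forall (pi pih : 'I_T -> 'S_n) (wt : nat -> 'rV[R]_p),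
    algorithm1_run D o gamma (fun=> eta) pi pih wt0 wt ->
    T.+1%:R^-1 *
      \sum_(0 <= t < T.+1) enorm (gradient_mapping D gamma eta (wt t)) ^+ 2
    <= eps ^+ 2])
  /\
  (forall nLambda1 : R, exists c C : R, [/\ 0 < c, 0 < C &
    forall n : nat, (0 < n)%N -> n%:R * Lambda1 = nLambda1 ->
    \forall eps \near 0^'+,
    forall (p q m : nat) (D : minimax R n p q m) (wt0 : 'rV[R]_p)
      (o : estimator),
    let eta := c * Num.sqrt n%:R * eps in
    let T := `|Num.ceil (C * (Num.sqrt n%:R)^-1 * eps ^- 3)|%N in
    has_constants D wt0 muh gamma Mh normK mF lF sigmaJ Delta supb ->
    gradient_growth D gamma eta Lambda0 Lambda1 ->
    forall (d : measure_display) (Om : measurableType d)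
      (P : probability Om R) (pi pih : 'I_T -> Om -> 'S_n)
      (wt : nat -> Om -> 'rV[R]_p),
    random_permutations P pi pih ->
    (forall om, algorithm1_run D o gamma (fun=> eta)
       (fun t => pi t om) (fun t => pih t om) wt0 (fun t => wt t om)) ->
    ((T.+1%:R^-1)%:E *
      \sum_(0 <= t < T.+1)
        'E_P[(fun om => enorm (gradient_mapping D gamma eta (wt t om)) ^+ 2)%R]
    <= (eps ^+ 2)%:E)%E]).
Proof.
move=> gamma0 sigma0 Lambda0_ge1 Lambda1_ge0.
(* [L] and [B] are [smoothness] and [grad_bound] written with the given constants, so that [c] and
   [C] do not depend on the instance. Their signs are not known before an instance is given, hence
   [|L|] below. *)
pose L := lF * (normK * Mh) + mF ^+ 2 * normK ^+ 2 / (muh + gamma).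
pose B := mF * (normK * Mh).
pose Gap := Delta + 2 * (gamma * supb).
split.
  (* The first bound of [run_step] has error [3 / 2 * eta * (L * (eta * B)) ^+ 2], that is
     [eta ^+ 3 * E]. *)
  pose E := 3 / 2 * L ^+ 2 * B ^+ 2.
  have E0 : 0 <= E by rewrite /E mulr_ge0 ?sqr_ge0// mulr_ge0 ?sqr_ge0.
  pose c := (4 * (1 + E))^-1; pose C := 16 * (`|Gap| + 1) / c.
  have c0 : 0 < c by rewrite invr_gt0; lra.
  have C0 : 0 < C by rewrite divr_gt0// mulr_gt0// ltr_wpDl.
  exists c, C; split => //.
  have K0 : 0 < c * (4 * `|L| + 1) by rewrite mulr_gt0// ltr_wpDl// mulr_ge0.
  apply: filterS (near0_small K0) => eps [e0 small] n p q m D wt0 o n0.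
  pose eta := c * eps; pose T := `|Num.ceil (C * eps ^- 3)|%N; rewrite -/eta -/T.
  move=> [HA start kE mE lE dE sE] growth pi pih wt run.
  have eta0 : 0 < eta by rewrite mulr_gt0.
  have LE : smoothness D muh Mh gamma = L by rewrite /smoothness kE mE lE.
  have BE : grad_bound D Mh = B by rewrite /grad_bound kE mE.
  have Leta : 4 * smoothness D muh Mh gamma * eta <= 1.
    have := ler_wpM2r (ltW eta0) (ler_norm L); rewrite LE.
    by move: small; rewrite mulrAC -/eta; lra.
  have [lo [a0 [f0 gap psi_ge]]] := psi_gap HA gamma0 sigma0 start dE sE.
  apply: (@rate_le _ _ _ Gap E 1) => //.
    rewrite invr1 mulr1; apply: le_natceil.
    by rewrite mulr_ge0 ?invr_ge0 ?exprn_ge0 ?(ltW C0) ?(ltW e0).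
  rewrite mulr1 expr1n invr1 mulr1 -/c -/eta.
  apply: le_trans (telescope_le (s := fun t => psi D gamma (wt t))
    (a := fun t => enorm (gradient_mapping D gamma eta (wt t)) ^+ 2)
    (d := eta ^+ 3 * E) (lo := lo) _ _) _.
  - move=> t tT.
    have := (run_step HA gamma0 sigma0 n0 eta0 Leta f0 run (Ordinal tT)).1.
    rewrite LE BE /= /E.
    have := mulr_ge0 (ltW eta0) (sqr_ge0 (enorm (gradient_mapping D gamma eta (wt t)))).
    rewrite (_ : 3 / 2 * eta * _ = eta ^+ 3 * (3 / 2 * L ^+ 2 * B ^+ 2)); last by ring.
    lra.
  - have := run_last HA gamma0 sigma0 n0 eta0 Leta f0 run psi_ge.
    have := mulr_ge0 (ltW eta0) (sqr_ge0 (enorm (gradient_mapping D gamma eta (wt T)))).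
    lra.
  - by rewrite lerD2r run.1.
move=> nLambda1.
(* The constant required by [random_descent]; the absolute value keeps it nonnegative, as [nLambda1]
   is still an arbitrary real here. *)
pose E := 3 * L ^+ 2 * (2 * `|nLambda1| + 2 * B ^+ 2 + 1).
have E0 : 0 <= E.
  have := normr_ge0 nLambda1; have := sqr_ge0 B; have := sqr_ge0 L => L2 B2 n2.
  by apply: mulr_ge0; lra.
pose c := (4 * (1 + E))^-1; pose C := 16 * (`|Gap| + 1) / c.
have c0 : 0 < c by rewrite invr_gt0; lra.
have C0 : 0 < C by rewrite divr_gt0// mulr_gt0// ltr_wpDl.
exists c, C; split => // n n0 nLE.
pose s : R := Num.sqrt n%:R.
have s0 : 0 < s by rewrite sqrtr_gt0 ltr0n.
have sE : s ^+ 2 = n%:R by rewrite sqr_sqrtr.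
(* The single condition [Q * eta <= 1] yields all three smallness conditions; the summand 1 gives
   [eta <= 1], which handles those in [eta ^+ 2]. [Q] may involve [n], which is fixed before
   [eps]. *)
pose Q := 4 * `|L| + 48 * (L ^+ 2 * Lambda0) + L ^+ 2 * B ^+ 2 * n%:R + 1.
have Q1 : 0 <= 48 * (L ^+ 2 * Lambda0).
  by rewrite mulr_ge0// mulr_ge0 ?sqr_ge0//; lra.
have Q2 : 0 <= L ^+ 2 * B ^+ 2 * n%:R by rewrite mulr_ge0// mulr_ge0 ?sqr_ge0.
have Q0 : 0 < Q by rewrite /Q; have := normr_ge0 L; lra.
have K0 : 0 < c * s * Q by rewrite !mulr_gt0.
apply: filterS (near0_small K0) => eps [e0 small] p q m D wt0 o.
pose eta := c * s * eps; pose T := `|Num.ceil (C * s^-1 * eps ^- 3)|%N.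
rewrite -/s -/eta -/T.
move=> [HA start kE mE lE dE sE'] growth d Om P pi pih wt [Xd Xu Xi] run.
have eta0 : 0 < eta by rewrite !mulr_gt0.
have Qeta : Q * eta <= 1 by move: small; rewrite mulrAC mulrC.
have LE : smoothness D muh Mh gamma = L by rewrite /smoothness kE mE lE.
have BE : grad_bound D Mh = B by rewrite /grad_bound kE mE.
have small_part x : 0 <= x -> x <= Q -> x * eta <= 1.
  by move=> x0 xQ; apply: le_trans Qeta; rewrite ler_wpM2r// ltW.
have eta1 : eta <= 1.
  by rewrite -[eta]mul1r small_part// /Q; have := normr_ge0 L; lra.
have small_part2 x : 0 <= x -> x <= Q -> x * eta ^+ 2 <= 1.
  move=> x0 xQ; apply: le_trans (small_part x x0 xQ).
  by rewrite ler_wpM2l// expr2 ler_piMl// ltW.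
have Leta : 4 * smoothness D muh Mh gamma * eta <= 1.
  rewrite LE; apply: (@le_trans _ _ (4 * `|L| * eta)).
    by rewrite ler_wpM2r ?(ltW eta0)// ler_wpM2l// ler_norm.
  by apply: small_part; [rewrite mulr_ge0|rewrite /Q; lra].
have Leta2 : 48 * (smoothness D muh Mh gamma ^+ 2 * Lambda0) * eta ^+ 2 <= 1.
  by rewrite LE; apply: small_part2 => //; rewrite /Q; have := normr_ge0 L; lra.
have LBeta : smoothness D muh Mh gamma ^+ 2 * grad_bound D Mh ^+ 2 * n%:R * eta ^+ 2 <= 1.
  by rewrite LE BE; apply: small_part2 => //; rewrite /Q; have := normr_ge0 L; lra.
have [lo [a0 [f0 gap psi_ge]]] := psi_gap HA gamma0 sigma0 start dE sE'.
pose X (j : 'I_T * bool) := if j.2 then pi j.1 else pih j.1.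
(* One outcome is chosen for each tuple of permutations, which transports the run to the finite
   sample space. *)
have [rep repE] := choice (joint_surjective Xu Xi).
pose W x := wt^~ (rep x).
have XE x j : X j (rep x) = x j by rewrite -[in RHS](repE x) ffunE.
have runW (x : {ffun 'I_T * bool -> 'S_n}) : algorithm1_run D o gamma (fun=> eta)
    (fun t => x (t, true)) (fun t => x (t, false)) wt0 (W x).
  have -> : (fun t : 'I_T => x (t, true)) = (fun t => pi t (rep x)).
    by apply/funext => t; rewrite -XE.
  have -> : (fun t : 'I_T => x (t, false)) = (fun t => pih t (rep x)).
    by apply/funext => t; rewrite -XE.
  exact: run.
(* By determinism, the run at any outcome is the run at the representative of its tuple; so the
   iterates are functions of [joint X], and their expectations are finite means. *)
have wtE t om : (t <= T)%N -> wt t om = W (joint X om) t.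
  move=> tT; apply: (run_unique tT (run om) (runW _)) => u _.
  by rewrite !ffunE.
pose sqG t x := enorm (gradient_mapping D gamma eta (W x t)) ^+ 2.
have EE t : (t <= T)%N ->
    ('E_P[(fun om => enorm (gradient_mapping D gamma eta (wt t om)) ^+ 2)%R] =
     (mean (sqG t))%:E)%E.
  move=> tT; have -> : (fun om => enorm (gradient_mapping D gamma eta (wt t om)) ^+ 2)
      = sqG t \o joint X by apply/funext => om; rewrite /= /sqG -wtE.
  by apply: expectation_joint => // x; exact: sqr_ge0.
rewrite (eq_big_nat _ _ (F2 := fun t => (mean (sqG t))%:E)); last first.
  by move=> t /andP[_ tT]; exact: EE.
rewrite sumEFin -EFinM lee_fin.
apply: (@rate_le _ _ _ Gap E s) => //.
  apply: le_natceil.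
  rewrite mulr_ge0 ?invr_ge0 ?exprn_ge0 ?(ltW e0)//.
  by rewrite mulr_ge0 ?invr_ge0 ?(ltW s0) ?(ltW C0).
rewrite -/c -/eta sE.
apply: le_trans (random_descent HA gamma0 sigma0 n0 eta0 growth f0 runW psi_ge
  Leta Leta2 LBeta (E := E) _) _; last by rewrite lerD2r.
rewrite LE BE nLE /E ler_wpM2l//; first by rewrite mulr_ge0 ?sqr_ge0.
by have := ler_norm nLambda1; lra.
Qed.
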